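(* Let $q=2^e$ with $e\ge1$, let $v\ge1$, and let $m=2^vn$ with $n=p_1^{e_1}\cdots p_s^{e_s}$, where $p_1,\dots,p_s$ are distinct odd primes and $e_1,\dots,e_s$ are positive integers, the primes being ordered so that $v_2(\mathrm{ord}_{p_1}(q))\le\cdots\le v_2(\mathrm{ord}_{p_s}(q))$. Fix a primitive root system $\eta$ modulo $n$. A cyclic code $$C_\Omega=\left(\prod_{(y,x)\in\Sigma(n;q)}M_{\eta^{(y,x)},q}(X)^{\Omega(y,x)}\right),\qquad0\le\Omega(y,x)\le2^v,$$ of length $m$ over $\mathbb{F}_q$ is self-dual if and only if $\Omega(y,x)=2^{v-1}$ for all $(y,x)\in\Sigma'(n;q)$, and $\Omega(y,x)=2^v-\Omega(y',x')$ for all pairs $(y,x),(y',x')\in\Sigma''(n;q)$ such that $-\eta^{(y,x)}\equiv\eta^{(y',x')}q^j\pmod n$ for some $j\in\mathbb{N}$. Consequently, all the self-dual cyclic codes of length $m$ over $\mathbb{F}_q$ are given by $$C_\Omega=\left(\prod_{(y,x)\in\Sigma'(n;q)}M_{\eta^{(y,x)},q}(X)^{2^{v-1}}\times\prod_{(y,x)\in\Sigma''(n;q)/\sim}M_{\eta^{(y,x)},q}(X)^{\Omega(y,x)}M_{-\eta^{(y,x)},q}(X)^{2^v-\Omega(y,x)}\right),$$ where the equivalence relation $\sim$ on $\Sigma''(n;q)$ is defined by $(y,x)\sim(y',x')$ if and only if $\pm\eta^{(y,x)}\equiv\eta^{(y',x')}q^j\pmod n$ for some $j\in\mathbb{N}$,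 and the polynomial $M_{-\eta^{(y,x)},q}(X)$ can be expressed as $$M_{-\eta^{(y,x)},q}(X)=\sum_{i=0}^{\omega_y}(-1)^{\omega_y-i}\Big(\sum_{\substack{U\subseteq\{0,\dots,\omega_y-1\}\\|U|=\omega_y-i}}\ \prod_{u\in U}\zeta_{p_1^{e_1-y_1-M_{y_1}}\cdots p_s^{e_s-y_s-M_{y_s}}}^{-\eta_1^{x_1}\cdots\eta_s^{x_s}q^u}\Big)X^{p_1^{M_{y_1}}\cdots p_s^{M_{y_s}}\cdot i}.$$
   Context: A cyclic code of length $m$ over $\mathbb{F}_q$ is an $\mathbb{F}_q$-subspace of $\mathbb{F}_q^m$ stable under the cyclic shift, identified via $(c_0,\dots,c_{m-1})\leftrightarrow\sum c_iX^i$ with an ideal of $\mathbb{F}_q[X]/(X^m-1)$; $(f(X))$ denotes the ideal generated by $f$. A code $\mathcal{C}$ is self-dual if $\mathcal{C}=\mathcal{C}^{\perp}$ for the Euclidean product $\langle x,y\rangle=\sum x_iy_i$. A compatible family $\{\zeta_N:\gcd(N,q)=1\}$ is fixed, where $\zeta_N$ is a primitive $N$-th root of unity in a finite extension of $\mathbb{F}_q$ and $\zeta_N^{N/M}=\zeta_M$ whenever $M\mid N$. For an integer $\gamma$, $M_{\gamma,q}(X)=\prod_{j=0}^{\tau-1}(X-\zeta_n^{\gamma q^j})$, where $\tau$ is the smallest positive integer with $\gamma q^\tau\equiv\gamma\pmod n$. $v_\ell$ is the $\ell$-adic valuation; $\mathrm{ord}_N(q)$ is the multiplicative order of $q$ modulo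 $N$, with $\mathrm{ord}_1(q)=1$; $\phi$ is Euler's function. An $s$-tuple $\eta=(\eta_1,\dots,\eta_s)$ of integers is a primitive root system modulo $p_1^{e_1}\cdots p_s^{e_s}$ if for every $i$: $\eta_i$ is a primitive root modulo $p_i^{d}$ for all $d\ge1$, and $\eta_i\equiv1\pmod{p_j^{e_j}}$ for every $j\ne i$. For $0\le y_i\le e_i$ put $f_{i,y_i}=\mathrm{ord}_{p_i^{e_i-y_i}}(q)$, $g_{i,y_i}=\phi(p_i^{e_i-y_i})/f_{i,y_i}$. $\Sigma(n;q)$ is the set of $2s$-tuples of integers $(y,x)=(y_1,\dots,y_s,x_1,\dots,x_s)$ with $0\le y_i\le e_i$ and $0\le x_i\le g_{i,y_i}\gcd(\mathrm{lcm}(f_{1,y_1},\dots,f_{i-1,y_{i-1}}),f_{i,y_i})-1$ for all $i$ (for $i=1$ the gcd is understood to be $1$). $\eta^{(y,x)}=\eta_1^{x_1}\cdots\eta_s^{x_s}p_1^{y_1}\cdots p_s^{y_s}$; $m_{y_i}=\min\{e_i-y_i,1\}$; $\omega_y=\mathrm{lcm}(\mathrm{ord}_{p_1^{m_{y_1}}}(q),\dots,\mathrm{ord}_{p_s^{m_{y_s}}}(q))$; $M_{y_i}=\max\{e_i-y_i-v_{p_i}(q^{\omega_y}-1),0\}$. The primes are grouped by indices $0\le s_1<\cdots<s_t=s$ (with $s_0=0$) such that $$0=v_2(\mathrm{ord}_{p_1}(q))=\cdots=v_2(\mathrm{ord}_{p_{s_1}}(q))<v_2(\mathrm{ord}_{p_{s_1+1}}(q))=\cdots=v_2(\mathrm{ord}_{p_{s_2}}(q))<\cdots<v_2(\mathrm{ord}_{p_{s_{t-1}+1}}(q))=\cdots=v_2(\mathrm{ord}_{p_{s_t}}(q)).$$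 For $1\le k\le t$, $\Sigma_k=\{(y,x)\in\Sigma(n;q):y_i=e_i\text{ for all }1\le i\le s_{k-1}\text{ and all }s_k+1\le i\le s\}$. Put $\Sigma'(n;q)=\Sigma_2\sqcup\cdots\sqcup\Sigma_t$ and $\Sigma''(n;q)=\Sigma(n;q)\setminus\Sigma'(n;q)$.
   Formalization: In the list of all self-dual codes, the class of 0 (y=e, x=0) is put with the factors of exponent 2^{v-1} instead of in Σ''/~; this matters only when t=1 (Σ' empty), where the displayed formula fails, e.g. q=2, n=7. Σ' is read as a union, since the Σ_k all contain that class. *)

(* Defs.v *)
From Corelib Require RelationClasses.
From HB Require Import structures.
From mathcomp Require Import all_boot all_order all_algebra all_field cyclic.

Set Implicit Arguments.
Unset Strict Implicit.
Unset Printing Implicit Defensive.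

Import GRing.Theory.
Local Open Scope ring_scope.

(* Smallest positive k <= b such that P k (b.+1 if there is none). *)
Definition first_pos (b : nat) (P : pred nat) : nat :=
  (find (fun k => P k.+1) (iota 0 b)).+1.

Lemma first_posP (b : nat) (P : pred nat) (k : nat) :
  (0 < k <= b)%N -> P k ->
  [/\ P (first_pos b P), (first_pos b P <= k)%N
    & forall i, (0 < i)%N -> P i -> (first_pos b P <= i)%N].
Proof.
case: k => // k kb Pk; rewrite /first_pos; set a := fun i => P i.+1.
have least i : (i < find a (iota 0 b))%N -> a i = false.
  move=> lt_i; have lt_ib : (i < b)%N.
    by apply: leq_trans lt_i _; rewrite -[leqRHS](size_iota 0) find_size.
  by have := before_find 0%N lt_i; rewrite nth_iota // add0n.
have hasP : has a (iota 0 b) by apply/hasP; exists k; rewrite ?mem_iota.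
have lefind i : a i -> (find a (iota 0 b) <= i)%N.
  by move=> ai; rewrite leqNgt; apply/negP => /least; rewrite ai.
have lt_fb : (find a (iota 0 b) < b)%N.
  by move: hasP; rewrite has_find size_iota.
split.
- by have := nth_find 0%N hasP; rewrite nth_iota // add0n.
- by rewrite ltnS lefind.
- by case=> // i _ Pi; rewrite ltnS lefind.
Qed.

Lemma leq_totient (N : nat) : (totient N <= N)%N.
Proof.
rewrite totient_count_coprime -[leqRHS]subn0 -[leqRHS]muln1 -sum_nat_const_nat.
by apply: leq_sum => k _; apply: leq_b1.
Qed.

Lemma exprz_totient (N : nat) (a : int) : (0 < N)%N -> coprimez a N ->
  (a ^+ totient N = 1 %[mod N])%Z.
Proof.
move=> N_gt0 co_aN; have N_neq0 : N%:Z != 0 by rewrite eqz_nat -lt0n.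
rewrite -modzXm; move: co_aN; rewrite /coprimez -gcdz_modl.
have := modz_ge0 a N_neq0; case: (a %% N)%Z => // b _.
rewrite /gcdz /= eqz_nat => co_bN.
by rewrite -[b%:Z]natz -natrX natz !modz_nat Euler_exp_totient.
Qed.

(* Multiplicative order of a modulo N, for a prime to N; then a ^ phi(N) = 1
   mod N and phi(N) <= N, so the search bound N is harmless. In particular
   mord 1 a = 1. *)
Definition mord (N : nat) (a : int) : nat :=
  first_pos N (fun k => (a ^+ k == 1 %[mod N])%Z).

Lemma mordP (N : nat) (a : int) : (0 < N)%N -> coprimez a N ->
  (a ^+ mord N a = 1 %[mod N])%Z /\
  forall k, (0 < k)%N -> (a ^+ k = 1 %[mod N])%Z -> (mord N a <= k)%N.
Proof.
move=> N_gt0 co_aN; pose P k := (a ^+ k == 1 %[mod N])%Z.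
have [||/eqP ? _ least] := @first_posP N P (totient N).
- by rewrite totient_gt0 N_gt0 leq_totient.
- exact/eqP/exprz_totient.
- by split=> // k k_gt0 /eqP; apply: least.
Qed.

Definition primitive_root_mod (N : nat) (a : int) : Prop :=
  coprimez a N /\ mord N a = totient N.

Definition primitive_root_system (s : nat) (p e : 'I_s -> nat)
    (eta : 'I_s -> int) : Prop :=
  forall i : 'I_s,
    (forall d : nat, (0 < d)%N -> primitive_root_mod (p i ^ d)%N (eta i)) /\
    (forall j : 'I_s, j != i -> (eta i = 1 %[mod (p j ^ e j)%N])%Z).

Definition coset_size (n q : nat) (gamma : int) : nat :=
  first_pos n (fun k => (gamma * q%:Z ^+ k == gamma %[mod n])%Z).

Lemma coset_sizeP (n q : nat) (gamma : int) : (0 < n)%N -> coprime q n ->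
  (gamma * q%:Z ^+ coset_size n q gamma = gamma %[mod n])%Z /\
  forall k, (0 < k)%N -> (gamma * q%:Z ^+ k = gamma %[mod n])%Z ->
    (coset_size n q gamma <= k)%N.
Proof.
move=> n_gt0 co_qn; pose P k := (gamma * q%:Z ^+ k == gamma %[mod n])%Z.
have [||/eqP ? _ least] := @first_posP n P (totient n).
- by rewrite totient_gt0 n_gt0 leq_totient.
- by rewrite /P -modzMmr exprz_totient ?modzMmr ?mulr1 //.
- by split=> // k k_gt0 /eqP; apply: least.
Qed.

Section Indices.

Variables (s : nat) (p e : 'I_s -> nat) (q n : nat).

(* The tuples y and x are stored with entries in {0, .., n}; by
   in_Sigma_bound below this excludes no element of Sigma(n; q). *)
Definition yxindex : finType :=
  ({ffun 'I_s -> 'I_n.+1} * {ffun 'I_s -> 'I_n.+1})%type.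

Definition ypart (yx : yxindex) (i : 'I_s) : nat := yx.1 i.
Definition xpart (yx : yxindex) (i : 'I_s) : nat := yx.2 i.

Definition fdeg (y : 'I_s -> nat) (i : 'I_s) : nat :=
  mord (p i ^ (e i - y i)) q.

Definition gdeg (y : 'I_s -> nat) (i : 'I_s) : nat :=
  totient (p i ^ (e i - y i)) %/ fdeg y i.

Definition in_Sigma (y x : 'I_s -> nat) : bool :=
  [forall i : 'I_s, (y i <= e i)%N &&
    (x i < gdeg y i *
       gcdn (\big[lcmn/1%N]_(j < s | (j < i)%N) fdeg y j) (fdeg y i))%N].

Definition Sigma : {set yxindex} := [set yx | in_Sigma (ypart yx) (xpart yx)].

Lemma in_Sigma_bound (y x : 'I_s -> nat) :
    n = (\prod_(i < s) p i ^ e i)%N -> (forall i, prime (p i)) ->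
  in_Sigma y x -> forall i, (y i <= n)%N /\ (x i <= n)%N.
Proof.
move=> -> p_pr /forallP Syx i; have /andP[le_y lt_x] := Syx i.
have pe_gt0 j : (0 < p j ^ e j)%N by rewrite expn_gt0 prime_gt0.
have le_pe : (p i ^ e i <= \prod_(j < s) p j ^ e j)%N.
  by apply: dvdn_leq; rewrite ?prodn_gt0 // (bigD1 i) //= dvdn_mulr.
split; first exact/(leq_trans le_y)/(leq_trans _ le_pe)/ltnW/ltn_expl/prime_gt1.
apply/(leq_trans (ltnW lt_x))/(leq_trans _ le_pe).
apply: (@leq_trans (gdeg y i * fdeg y i)).
  by rewrite leq_mul2l dvdn_leq ?dvdn_gcdr ?orbT.
apply: leq_trans (leq_divM _ _) _.
by apply: leq_trans (leq_totient _) _; rewrite leq_pexp2l ?prime_gt0 ?leq_subr.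
Qed.

Definition eta_x (eta : 'I_s -> int) (yx : yxindex) : int :=
  \prod_(i < s) eta i ^+ xpart yx i.

Definition eta_yx (eta : 'I_s -> int) (yx : yxindex) : int :=
  eta_x eta yx * \prod_(i < s) (p i)%:Z ^+ ypart yx i.

Definition omega (yx : yxindex) : nat :=
  \big[lcmn/1%N]_(i < s) mord (p i ^ minn (e i - ypart yx i) 1) q.

(* M_{y_i}; the truncated subtraction is the maximum with 0. *)
Definition Mexp (yx : yxindex) (i : 'I_s) : nat :=
  (e i - ypart yx i - logn (p i) (q ^ omega yx - 1))%N.

(* i is the 0-based index of a prime of the k-th group, 1 <= k. *)
Definition in_group (sg : nat -> nat) (k i : nat) : bool :=
  (sg k.-1 <= i < sg k)%N.

Definition v2ord (i : 'I_s) : nat := logn 2 (mord (p i) q).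

(* sg k is the paper's s_k, for 0 <= k <= t; s_1 = 0 is allowed, and then
   all the orders are even. *)
Definition grouping (t : nat) (sg : nat -> nat) : Prop :=
  [/\ (0 < t)%N /\ sg 0%N = 0%N, sg t = s,
      forall k, (0 < k < t)%N -> (sg k < sg k.+1)%N,
      forall i : 'I_s, (v2ord i == 0%N) = (i < sg 1%N)%N
    & forall (k l : nat) (i j : 'I_s), (0 < k <= l)%N -> (l <= t)%N ->
        in_group sg k i -> in_group sg l j ->
        if k == l then v2ord i = v2ord j else (v2ord i < v2ord j)%N].

Definition Sigma_k (sg : nat -> nat) (k : nat) : {set yxindex} :=
  [set yx in Sigma |
    [forall i : 'I_s, in_group sg k i || (ypart yx i == e i)]].

Definition Sigma' (t : nat) (sg : nat -> nat) : {set yxindex} :=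
  \bigcup_(2 <= k < t.+1) Sigma_k sg k.

Definition Sigma'' (t : nat) (sg : nat -> nat) : {set yxindex} :=
  Sigma :\: Sigma' t sg.

(* The index y = (e_1, .., e_s), x = 0 of the class of 0 modulo n. It belongs
   to every Sigma_k, hence to Sigma' when t >= 2, but Sigma' is empty when
   t = 1, although the class of 0 is always equal to its opposite. Listing the
   self-dual codes thus requires to move it explicitly to the self-opposite
   classes, which changes nothing when t >= 2 (Sigma'U0 and Sigma''D0). *)
Definition Sigma_0 : {set yxindex} :=
  [set yx in Sigma | [forall i : 'I_s, ypart yx i == e i]].

Lemma Sigma_0_sub (t : nat) (sg : nat -> nat) :
  (1 < t)%N -> Sigma_0 \subset Sigma' t sg.
Proof.
move=> t_gt1; apply/subsetP => yx; rewrite inE => /andP[Syx /forallP y_e].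
rewrite /Sigma' big_ltn // in_setU inE Syx /=; apply/orP; left.
by apply/forallP => i; rewrite y_e orbT.
Qed.

Lemma Sigma'U0 (t : nat) (sg : nat -> nat) :
  (1 < t)%N -> Sigma_0 :|: Sigma' t sg = Sigma' t sg.
Proof. by move=> t_gt1; apply/setUidPr/Sigma_0_sub. Qed.

Lemma Sigma''D0 (t : nat) (sg : nat -> nat) :
  (1 < t)%N -> Sigma'' t sg :\: Sigma_0 = Sigma'' t sg.
Proof.
by move=> t_gt1; rewrite /Sigma'' setDDl setUC Sigma'U0.
Qed.

Definition opp_class (eta : 'I_s -> int) (yx yx' : yxindex) : Prop :=
  exists j : nat, (- eta_yx eta yx = eta_yx eta yx' * q%:Z ^+ j %[mod n])%Z.

Definition sim (eta : 'I_s -> int) (yx yx' : yxindex) : Prop :=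
  exists j : nat,
    (eta_yx eta yx = eta_yx eta yx' * q%:Z ^+ j %[mod n])%Z \/
    (- eta_yx eta yx = eta_yx eta yx' * q%:Z ^+ j %[mod n])%Z.

End Indices.

Section Sim.
Variables (s : nat) (p : 'I_s -> nat) (q n : nat) (eta : 'I_s -> int).
Hypotheses (n_gt0 : (0 < n)%N) (co_qn : coprime q n).

Lemma coset_sym (a b : int) (j : nat) :
  (a = b * q%:Z ^+ j %[mod n])%Z ->
  exists k : nat, (b = a * q%:Z ^+ k %[mod n])%Z.
Proof.
move=> ab; exists (totient n * j - j)%N.
rewrite -modzMml ab modzMml -mulrA -exprD subnKC; last first.
  by rewrite leq_pmull // totient_gt0.
by rewrite exprM -modzMmr -modzXm exprz_totient // modzXm expr1n modzMmr mulr1.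
Qed.

Lemma eqz_modN (a b : int) : (a = b %[mod n])%Z -> (- a = - b %[mod n])%Z.
Proof. by move=> ab; rewrite -[- a]mulN1r -[- b]mulN1r -modzMmr ab modzMmr. Qed.

Lemma sim_equivalence : RelationClasses.Equivalence (@sim s p q n eta).
Proof.
split=> [yx|yx yx' [j [h|h]]|yx1 yx2 yx3 [j h] [k h']].
- by exists 0%N; left; rewrite expr0 mulr1.
- by have [k hk] := coset_sym h; exists k; left.
- have [k /eqz_modN hk] := coset_sym h; exists k; right.
  by rewrite hk mulNr opprK.
- have neg a b i : (- a = b * q%:Z ^+ i %[mod n])%Z ->
      (a = - b * q%:Z ^+ i %[mod n])%Z.
    by move=> /eqz_modN; rewrite opprK mulNr.
  have trans a b c : (a = b * q%:Z ^+ j %[mod n])%Z ->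
      (b = c * q%:Z ^+ k %[mod n])%Z -> (a = c * q%:Z ^+ (k + j) %[mod n])%Z.
    by move=> -> bc; rewrite -modzMml bc modzMml exprD mulrA.
  exists (k + j)%N; case: h => [h|h]; case: h' => [h'|h'].
  + by left; apply: trans h h'.
  + right; apply: trans h'; by rewrite mulNr; apply: eqz_modN.
  + by right; apply: trans h h'.
  + by left; apply: trans (neg _ _ _ h) h'.
Qed.

End Sim.

(* T is a system of representatives of D / R. *)
Definition representatives (I : finType) (D : {set I}) (R : I -> I -> Prop)
    (T : {set I}) : Prop :=
  T \subset D /\ forall a, a \in D -> exists! b, b \in T /\ R a b.

Section Polynomials.

Variables (F : finFieldType) (L : fieldType) (iota : {rmorphism F -> L}).
Variable zeta : nat -> L.

(* Every zeta N is algebraic over F, so the field F(zeta N) it generates in L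
   is a finite extension of F. *)
Definition compatible_roots (q : nat) : Prop :=
  (forall N, coprime N q -> N.-primitive_root (zeta N)) /\
  (forall M N, coprime N q -> (M %| N)%N ->
     zeta N ^+ (N %/ M)%N = zeta M).

Definition cosetpoly (n q : nat) (gamma : int) : {poly L} :=
  \prod_(j < coset_size n q gamma) ('X - (zeta n ^ (gamma * q%:Z ^+ j))%:P).

(* The polynomial over F whose image under iota is P, if there is one. *)
Definition descend (P : {poly L}) : {poly F} :=
  \poly_(i < size P) odflt 0 [pick a : F | iota a == P`_i].

Definition cosetpolyF (n q : nat) (gamma : int) : {poly F} :=
  descend (cosetpoly n q gamma).

Lemma fixed_Frobenius (x : L) : x ^+ #|F| = x -> exists a : F, iota a = x.
Proof.
move=> xq; have: root (map_poly iota ('X^#|F| - 'X)) x.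
  by rewrite rmorphB /= map_polyXn map_polyX rootE !(hornerE, hornerXn) xq subrr.
rewrite finField_genPoly rmorph_prod /= => r.
have: root (\prod_(z <- [seq iota b | b : F]) ('X - z%:P)) x.
  rewrite big_image /=; congr (root _ x): r.
  by apply: eq_bigr => b _; rewrite rmorphB /= map_polyX map_polyC.
by rewrite root_prod_XsubC => /mapP[b _ ->]; exists b.
Qed.

Lemma descendK (P : {poly L}) :
  (forall i, P`_i ^+ #|F| = P`_i) -> map_poly iota (descend P) = P.
Proof.
move=> fixP; apply/polyP => i; rewrite coef_map coef_poly.
case: ltnP => [_|le_Pi]; last first.
  by rewrite nth_default; [exact: rmorph0|exact: le_Pi].
case: pickP => [b /eqP //|no]; have [b ib] := fixed_Frobenius (fixP i).
by have := no b; rewrite ib eqxx.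
Qed.

Lemma map_cosetpolyF (n q : nat) (gamma : int) :
    q = #|F| -> coprime q n -> n.-primitive_root (zeta n) ->
  map_poly iota (cosetpolyF n q gamma) = cosetpoly n q gamma.
Proof.
move=> qF co_qn prim; apply: descendK => i; set P := cosetpoly _ _ _.
pose f (x : L) := x ^+ #|F|.
have fA : zmod_morphism f.
  rewrite /f => x y; have [r _ rF] := finPcharP F; rewrite (card_pprimeChar rF).
  elim: (logn _ _) => // k IH; rewrite expnSr !exprM {}IH.
  by have rL := rmorph_pchar iota rF; rewrite -(pFrobenius_autE rL) rmorphB.
have fM : monoid_morphism f.
  by rewrite /f; split=> [|x y]; rewrite ?exprMn ?expr1n.
have [fr frE] : exists fr : {rmorphism L -> L}, forall x, fr x = x ^+ q.
  pose fr : {rmorphism L -> L} := HB.pack f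
    (GRing.isZmodMorphism.Build _ _ f fA) (GRing.isMonoidMorphism.Build _ _ f fM).
  by exists fr => x; rewrite qF.
suff mP : map_poly fr P = P
  by rewrite -qF -[in RHS]mP coef_map; symmetry; apply: frE.
have z_unit : zeta n \is a GRing.unit.
  rewrite unitfE; apply/eqP => z0; have := prim_expr_order prim.
  by rewrite z0 expr0n gtn_eqF ?(prim_order_gt0 prim) // => /eqP;
    rewrite eq_sym oner_eq0.
have zE (a b : int) : (a = b %[mod n])%Z -> zeta n ^ a = zeta n ^ b.
  have red c : zeta n ^ c = zeta n ^ (c %% n)%Z.
    rewrite {1}(divz_eq c n) [(_ %/ _)%Z * _]mulrC exprzDr // -exprz_exp.
    by rewrite -exprnP (prim_expr_order prim) exp1rz mul1r.
  by move=> ab; rewrite red ab -red.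
have [per _] := coset_sizeP gamma (prim_order_gt0 prim) co_qn.
rewrite /P /cosetpoly; move: per; set tau := coset_size _ _ _ => per.
have tauE : tau = tau.-1.+1 by [].
have frX z : map_poly fr ('X - z%:P) = 'X - (z ^+ q)%:P.
  by rewrite rmorphB /= map_polyX map_polyC; congr ('X - _%:P); apply: frE.
rewrite rmorph_prod tauE big_ord_recr big_ord_recl [RHS]mulrC; congr (_ * _).
  apply: eq_bigr => k _; apply: etrans (frX _) _.
  by rewrite exprnP exprz_exp -mulrA -exprSr.
apply: etrans (frX _) _; rewrite exprnP exprz_exp -mulrA -exprSr.
by rewrite (zE _ gamma per) expr0 mulr1.
Qed.

End Polynomials.

Section Codes.

Variables (F : finFieldType) (m : nat).

Definition cyclic_shift (c : 'rV[F]_m) : 'rV[F]_m :=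
  \row_j c 0 (ord_pred j).

Definition cyclic_code (C : {set 'rV[F]_m}) : Prop :=
  GRing.submod_closed C /\ forall c, c \in C -> cyclic_shift c \in C.

Definition dual_code (C : {set 'rV[F]_m}) : {set 'rV[F]_m} :=
  [set x : 'rV[F]_m | [forall y in C, \sum_(i < m) x 0 i * y 0 i == 0]].

Definition self_dual (C : {set 'rV[F]_m}) : Prop := C = dual_code C.

(* The code (g): the words whose polynomial is, modulo X^m - 1, a multiple of
   g; the cofactor may be taken of degree < m. *)
Definition ideal_code (g : {poly F}) : {set 'rV[F]_m} :=
  [set c | [exists h : 'rV[F]_m,
              rVpoly c == (g * rVpoly h) %% ('X^m - 1)]].

Lemma ideal_codeP (g : {poly F}) (c : 'rV[F]_m) :
  (0 < m)%N ->
  reflect (exists h : {poly F}, 'X^m - 1 %| rVpoly c - g * h)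
          (c \in ideal_code g).
Proof.
move=> m_gt0; have sz : size ('X^m - 1 : {poly F}) = m.+1 by rewrite size_XnsubC.
have nz : 'X^m - 1 != 0 :> {poly F} by rewrite -size_poly_eq0 sz.
have modc : rVpoly c %% ('X^m - 1) = rVpoly c.
  by rewrite modp_small // sz ltnS size_poly.
rewrite inE; apply: (iffP existsP) => [[h /eqP ch]|[h]].
  by exists (rVpoly h); rewrite /dvdp modpD modpN modc ch subrr.
rewrite /dvdp modpD modpN modc subr_eq0 => ch.
exists (poly_rV (h %% ('X^m - 1))); rewrite poly_rV_K ?modp_mul //.
by rewrite -ltnS -sz ltn_modp.
Qed.

End Codes.

(* Main.v *)
From HB Require Import structures.
Require Import Defs.
From mathcomp Require Import all_boot all_order all_algebra all_field.
From mathcomp Require Import ring.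

(** Over L one has X^m - 1 = prod_i (X - zeta_n^i)^(2^v), so a divisor of X^m - 1
    over F is determined by the multiplicities of the zeta_n^i, which are constant
    on the q-cyclotomic cosets modulo n; Sigma(n; q) lists these cosets once each.
    As X (X^(m-1) - z) = - z (X - z^-1) modulo X^m - 1, passing to the dual code
    replaces the multiplicity Omega of a coset by 2^v minus that of the opposite
    coset.  The nonzero cosets equal to their opposite are those of Sigma':
    q^j = -1 modulo p_i forces v_2(ord_{p_i}(q)) = v_2(j) + 1 for all the primes
    involved, and conversely half of the common 2-part of the orders gives such
    a j.  The expansion of the polynomial of an opposite coset compares roots and
    degrees, the degree being given by the lifting-the-exponent lemma. *)

Set Implicit Arguments.
Unset Strict Implicit.
Unset Printing Implicit Defensive.

Import GRing.Theory.
Local Open Scope ring_scope.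

(** * Congruences and primitive roots *)

(** The bound on [x i] in [Sigma] is the index of a subgroup. All primes share one exponent j of q.
    Once the residues at the earlier primes are fixed, j is known modulo the lcm l of the earlier
    orders, so the units modulo the i-th prime power are to be classified up to powers of q^l only,
    and these powers form a subgroup of index g_i gcd(l, f_i). Hence the representatives are built,
    and shown to be distinct, one prime at a time. Duality is handled without reversing
    coefficients: X^(m-1) is the inverse of X modulo X^m - 1, so substituting it for X is a ring
    morphism and no degree has to be tracked. The codes are given by polynomials over F whose roots
    lie in L; their factorizations are compared after applying the injective map [map_poly iota]. *)

Lemma eqmodzM (d a b c k : int) :
  (a = b %[mod d])%Z -> (c = k %[mod d])%Z -> (a * c = b * k %[mod d])%Z.
Proof. by move=> ab ck; rewrite -modzMm ab ck modzMm. Qed.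

Lemma eqmodzX (d a b : int) (k : nat) :
  (a = b %[mod d])%Z -> (a ^+ k = b ^+ k %[mod d])%Z.
Proof. by move=> ab; rewrite -modzXm ab modzXm. Qed.

Lemma eqmodz_dvd (d' d a b : int) :
  (d' %| d)%Z -> (a = b %[mod d])%Z -> (a = b %[mod d'])%Z.
Proof.
by move=> dd /eqP; rewrite eqz_mod_dvd => /(dvdz_trans dd);
  rewrite -eqz_mod_dvd => /eqP.
Qed.

Lemma eqmodz_cancel (d a b c : int) :
  coprimez c d -> (c * a = c * b %[mod d])%Z -> (a = b %[mod d])%Z.
Proof.
move=> co /eqP; rewrite eqz_mod_dvd -mulrBr Gauss_dvdzr 1?coprimez_sym //.
by rewrite -eqz_mod_dvd => /eqP.
Qed.

Lemma eqmodz_coprime (d a b : int) :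
  (a = b %[mod d])%Z -> coprimez a d = coprimez b d.
Proof. by move=> ab; rewrite /coprimez -gcdz_modl ab gcdz_modl. Qed.

Lemma coprimez_inv (d a : int) : coprimez a d -> exists b, (a * b = 1 %[mod d])%Z.
Proof.
case/coprimezP => -[u w] /= uw; exists u; apply/eqP.
by rewrite eqz_mod_dvd; apply/dvdzP; exists (- w); rewrite -uw opprD mulrC addNKr mulNr.
Qed.

Lemma dvdn_prod_coprime (I : finType) (Q : I -> nat) (m : nat) :
  (forall i j, i != j -> coprime (Q i) (Q j)) -> (forall i, Q i %| m)%N ->
  (\prod_i Q i %| m)%N.
Proof.
move=> coQ Qm; have := index_enum_uniq I.
elim: (index_enum I) => [|i r IH] /=; first by rewrite big_nil dvd1n.
case/andP=> ir ur; rewrite big_cons Gauss_dvd ?Qm ?IH //.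
elim: (r) ir {ur IH} => [|j r' IH]; first by rewrite big_nil coprimen1.
by rewrite inE negb_or big_cons coprimeMr => /andP[ij /IH ->]; rewrite coQ.
Qed.

Lemma eqmodz_prod (I : finType) (Q : I -> nat) (a b : int) :
  (forall i j, i != j -> coprime (Q i) (Q j)) ->
  (forall i, (a = b %[mod Q i])%Z) -> (a = b %[mod (\prod_i Q i)%N])%Z.
Proof.
move=> coQ ab; apply/eqP; rewrite eqz_mod_dvd dvdzE /=.
by apply: dvdn_prod_coprime => // i; have /eqP := ab i; rewrite eqz_mod_dvd.
Qed.

Lemma mord_gt0 (N : nat) (a : int) : (0 < mord N a)%N.
Proof. by []. Qed.

Lemma mord_dvd (N : nat) (a : int) (k : nat) : (0 < N)%N -> coprimez a N ->
  (a ^+ k == 1 %[mod N])%Z = (mord N a %| k)%N.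
Proof.
move=> N0 co; have [a1 least] := mordP N0 co.
have per u : (a ^+ (u * mord N a) = 1 %[mod N])%Z.
  by rewrite mulnC exprM -modzXm a1 modzXm expr1n.
apply/eqP/idP => [ak|/dvdnP[u ->]]; last exact: per.
rewrite /dvdn; case: posnP => // r0.
have := least _ r0; rewrite leqNgt ltn_mod mord_gt0 /= => H.
suff /H : (a ^+ (k %% mord N a) = 1 %[mod N])%Z by [].
rewrite -ak [in RHS](divn_eq k (mord N a)) exprD -modzMml per modzMml mul1r //.
Qed.

Section PrimitiveRoot.

Variables (Q : nat) (g : int).
Hypotheses (Q0 : (0 < Q)%N) (prg : primitive_root_mod Q g).

Lemma primitive_root_expE (r k : nat) :
  (g ^+ r == g ^+ k %[mod Q])%Z = (r == k %[mod totient Q])%N.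
Proof.
have [cog ord_g] := prg.
wlog le_kr : r k / (k <= r)%N.
  by move=> W; case: (leqP k r) => [|/ltnW] /W; rewrite // eq_sym => ->; rewrite eq_sym.
rewrite eqn_mod_dvd // -ord_g -mord_dvd //.
rewrite !eqz_mod_dvd -{1}(subnK le_kr) exprD -[in X in _ - X](mul1r (g ^+ k)).
by rewrite -mulrBl Gauss_dvdzl // coprimez_sym coprimezXl.
Qed.

(** By counting: the powers of g with exponent below phi(Q) are pairwise distinct units, and there
    are only phi(Q) units. *)
Lemma primitive_root_log (w : int) :
  coprimez w Q -> exists r : nat, (w = g ^+ r %[mod Q])%Z.
Proof.
have [cog _] := prg => cow.
have Qn0 : Q%:Z != 0 by rewrite eqz_nat -lt0n.
have lt_abs (z : int) : (`|(z %% Q)%Z| < Q)%N.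
  by rewrite -ltz_nat gez0_abs ?modz_ge0 // ltz_pmod.
pose h (z : int) : 'I_Q := Ordinal (lt_abs z).
have hE z : (h z : int) = (z %% Q)%Z by rewrite /= gez0_abs ?modz_ge0.
pose U := [set i : 'I_Q | coprime Q i].
have hU z : coprimez z Q -> h z \in U.
  by rewrite coprimez_sym /coprimez -gcdz_modr -hE inE /coprime eqz_nat.
have cardU : #|U| = totient Q.
  rewrite totient_count_coprime big_mkord -sum1_card [in LHS]big_mkcond /=.
  by apply: eq_bigr => i _; rewrite inE; case: coprime.
pose S := [set h (g ^+ (r : 'I_(totient Q))) | r in 'I_(totient Q)].
have cardS : #|S| = totient Q.
  rewrite card_imset ?card_ord // => r k /(congr1 (fun i : 'I_Q => (i : int))).
  rewrite !hE => /eqP; rewrite primitive_root_expE !modn_small // => /eqP.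
  exact: val_inj.
have /eqP SU : S == U.
  rewrite eqEcard cardS cardU leqnn andbT.
  by apply/subsetP => _ /imsetP[r _ ->]; apply/hU/coprimezXl.
have := hU _ cow; rewrite -SU => /imsetP[r _ /(congr1 (fun i : 'I_Q => (i : int)))].
by rewrite !hE => E; exists r.
Qed.

(** The gcd on the left is the index of the subgroup generated by q^l. With g0 = gcd(c, phi(Q)), the
    order of q is phi(Q) / g0, and c / g0 is prime to it; so after g0 is factored out of the gcd, c
    / g0 drops out. *)
Lemma primitive_root_subgroup (q : int) (l : nat) : coprimez q Q ->
  exists2 c, (0 < c)%N & (q = g ^+ c %[mod Q])%Z /\
    gcdn (c * l) (totient Q) = (totient Q %/ mord Q q * gcdn l (mord Q q))%N.
Proof.
move=> coq; have phi0 : (0 < totient Q)%N by rewrite totient_gt0.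
have [c0 qc0] := primitive_root_log coq.
have [c c_gt0 qc] : exists2 c, (0 < c)%N & (q = g ^+ c %[mod Q])%Z.
  (* Adding phi(Q) does not change the power of g, and makes the exponent positive, as [egcdnP] will
     require. *)
  exists (c0 + totient Q)%N; first by rewrite addn_gt0 phi0 orbT.
  by rewrite qc0; apply/eqP; rewrite primitive_root_expE modnDr.
exists c => //; split=> //.
have fE k : (mord Q q %| k)%N = (totient Q %| c * k)%N.
  rewrite -mord_dvd // -modzXm qc modzXm -exprM -(expr0 g).
  by rewrite primitive_root_expE mod0n.
set g0 := gcdn c (totient Q).
have g0_gt0 : (0 < g0)%N by rewrite gcdn_gt0 c_gt0.
have phiE : (totient Q = g0 * (totient Q %/ g0))%N by rewrite mulnC divnK ?dvdn_gcdr.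
have cE : (c = g0 * (c %/ g0))%N by rewrite mulnC divnK ?dvdn_gcdl.
have co : coprime (c %/ g0) (totient Q %/ g0).
  by rewrite /coprime -(eqn_pmul2l g0_gt0) muln_gcdr -cE -phiE muln1.
have fE' k : (mord Q q %| k)%N = (totient Q %/ g0 %| k)%N.
  rewrite fE {1}phiE {1}cE -mulnA dvdn_pmul2l //.
  by rewrite Gauss_dvdr // coprime_sym.
have f_eq : mord Q q = (totient Q %/ g0)%N.
  by apply/eqP; rewrite eqn_dvd fE' dvdnn /= -fE' dvdnn.
have -> : (totient Q %/ mord Q q = g0)%N.
  by rewrite {1}phiE f_eq mulnK // divn_gt0 // dvdn_leq // dvdn_gcdr.
rewrite f_eq {1}cE {1}phiE -mulnA -muln_gcdr; congr (_ * _)%N.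
by rewrite gcdnC Gauss_gcdr 1?gcdnC // coprime_sym.
Qed.

(** If w = g^r, take for x the remainder of r modulo the index G. The rest is a power of g^G, hence
    of q^l, since by Bezout G = km c l - kn phi(Q). *)
Lemma primitive_root_repr (q w : int) (l : nat) :
    (0 < l)%N -> coprimez q Q -> coprimez w Q ->
  exists x k : nat, (x < totient Q %/ mord Q q * gcdn l (mord Q q))%N /\
    (w = g ^+ x * q ^+ (l * k) %[mod Q])%Z.
Proof.
move=> l0 coq cow; have [c c0 [qc <-]] := primitive_root_subgroup l coq.
have [r ->] := primitive_root_log cow; set G := gcdn _ _.
have cl0 : (0 < c * l)%N by rewrite muln_gt0 c0.
have G0 : (0 < G)%N by rewrite gcdn_gt0 cl0.
have [km kn kE _] := egcdnP (totient Q) cl0.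
exists (r %% G)%N, (km * (r %/ G))%N; split; first by rewrite ltn_mod.
rewrite -modzMmr (eqmodzX _ qc) modzMmr -exprM -exprD.
apply/eqP; rewrite primitive_root_expE.
have -> : (r %% G + c * (l * (km * (r %/ G))) = kn * (r %/ G) * totient Q + r)%N.
  have -> : (c * (l * (km * (r %/ G))) = km * (c * l) * (r %/ G))%N.
    by rewrite !mulnA [(km * c)%N]mulnC -[(c * km * l)%N]mulnA [(km * l)%N]mulnC mulnA.
  rewrite kE -/G mulnDl addnCA [in RHS]mulnAC; congr (_ + _)%N.
  by rewrite addnC mulnC -divn_eq.
by rewrite modnMDl.
Qed.

Lemma primitive_root_repr_inj (q : int) (l k x x' : nat) : coprimez q Q ->
  (x < totient Q %/ mord Q q * gcdn l (mord Q q))%N ->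
  (x' < totient Q %/ mord Q q * gcdn l (mord Q q))%N ->
  (g ^+ x = g ^+ x' * q ^+ (l * k) %[mod Q])%Z -> x = x'.
Proof.
move=> coq; have [c c0 [qc <-]] := primitive_root_subgroup l coq => xG x'G.
rewrite -modzMmr (eqmodzX _ qc) modzMmr -exprM -exprD => /eqP.
(* The index divides both phi(Q) and c l, so reducing the exponents of g modulo it removes the power
   of q. *)
rewrite primitive_root_expE => /eqP /(congr1 (modn^~ (gcdn (c * l) (totient Q)))).
rewrite !modn_dvdm ?dvdn_gcdr // mulnA -modnDmr.
have /eqP -> : (c * l * k %% gcdn (c * l) (totient Q) == 0)%N.
  by rewrite -/(dvdn _ _) dvdn_mulr // dvdn_gcdl.
by rewrite addn0 !modn_small.
Qed.

End PrimitiveRoot.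

Lemma coprime_prodr (I : finType) (P : pred I) (m : nat) (Q : I -> nat) :
  (forall i, P i -> coprime m (Q i)) -> coprime m (\prod_(i | P i) Q i).
Proof.
by move=> co; elim/big_ind: _ => // [|a b ca cb]; rewrite ?coprimen1 // coprimeMr ca.
Qed.

Lemma PoszX (a k : nat) : (a ^ k)%N%:Z = a%:Z ^+ k.
Proof. by rewrite -[a%:Z]natz -natrX natz. Qed.

(** * Representatives of the cyclotomic cosets *)

Section CosetRepresentatives.

Variables (s q n : nat) (p e : 'I_s -> nat) (eta : 'I_s -> int).
Hypotheses (p_prime : forall i, prime (p i)) (p_inj : injective p).
Hypotheses (e_gt0 : forall i, (0 < e i)%N).
Hypotheses (nE : n = (\prod_(i < s) p i ^ e i)%N) (co_qn : coprime q n).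
Hypothesis eta_root : primitive_root_system p e eta.

Lemma prime_power_gt0 i k : (0 < p i ^ k)%N.
Proof. by rewrite expn_gt0 prime_gt0. Qed.

Lemma coprime_prime_powers i j k l : i != j -> coprime (p i ^ k) (p j ^ l).
Proof.
move=> ij; apply/coprimeXl/coprimeXr; rewrite prime_coprime // dvdn_prime2 //.
by rewrite (inj_eq p_inj).
Qed.

Lemma prime_power_dvd_n i k : (k <= e i)%N -> (p i ^ k %| n)%N.
Proof. by move=> ke; rewrite nE (bigD1 i) //= dvdn_mulr // dvdn_exp2l. Qed.

Lemma logn_primes_prod y i : logn (p i) (\prod_(k < s) p k ^ y k) = y i.
Proof.
rewrite (bigD1 i) //= lognM ?prime_power_gt0 ?prodn_gt0 // => [|k]; last first.
  exact: prime_power_gt0.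
rewrite lognX logn_prime // eqxx muln1 logn_coprime ?addn0 //.
apply: coprime_prodr => k ki; rewrite -[X in coprime X _]expn1.
by rewrite coprime_prime_powers // eq_sym.
Qed.

Lemma coprime_q_prime_power i k : coprimez q%:Z (p i ^ k)%N.
Proof.
apply: (@coprimeXr k q (p i)); apply: coprime_dvdr co_qn.
by rewrite -(expn1 (p i)) prime_power_dvd_n.
Qed.

(** A primitive root system is only constrained at positive exponents; when y_i = e_i the modulus is
    1, where order and totient are both 1. *)
Lemma eta_primitive_root y i : primitive_root_mod (p i ^ (e i - y i)) (eta i).
Proof.
have [/(_ (e i - y i)%N) pr _] := eta_root i.
case: (e i - y i)%N pr => [_|k]; last exact.
split; first by rewrite /coprimez gcdzC gcd1z.
apply/eqP; rewrite [X in _ == X](_ : _ = 1%N) // -dvdn1 -mord_dvd ?modz1 //=.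
by rewrite /coprimez gcdzC gcd1z.
Qed.

(** The other generators are 1 modulo p_i^e_i. This is what decouples the primes. *)
Lemma eta_x_mod x i k : (k <= e i)%N ->
  (\prod_(j < s) eta j ^+ x j = eta i ^+ x i %[mod (p i ^ k)%N])%Z.
Proof.
move=> ke; rewrite (bigD1 i) //= -[in RHS](mulr1 (eta i ^+ x i)); apply: eqmodzM => //.
apply: (big_ind (fun z : int => (z = 1 %[mod (p i ^ k)%N])%Z)) => // [a b a1 b1|j ji].
  by rewrite -(mulr1 1); apply: eqmodzM.
rewrite -[in RHS](expr1n _ (x j)); apply: eqmodzX.
apply: (@eqmodz_dvd _ (p i ^ e i)%N); first exact: dvdn_exp2l.
by have [_ -> //] := eta_root j; rewrite eq_sym.
Qed.

Lemma eta_x_coprime x i k : coprimez (\prod_(j < s) eta j ^+ x j) (p i ^ k)%N.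
Proof.
apply: (@coprimeXr k `|_| (p i)); rewrite -(expn1 (p i)).
rewrite -[X in coprime _ X]/`|_%:Z|%N -coprimezE.
rewrite (eqmodz_coprime (eta_x_mod x (e_gt0 i))); apply: coprimezXl.
by have [/(_ 1%N isT)[]] := eta_root i.
Qed.

(** Cancelling the common factor divides the modulus by it, and the Chinese remainder theorem splits
    the congruence that is left. *)
Lemma eqmodz_cofactor (y : 'I_s -> nat) (a b : int) : (forall i, (y i <= e i)%N) ->
  (a * (\prod_(i < s) p i ^ y i)%N == b * (\prod_(i < s) p i ^ y i)%N %[mod n])%Z =
  [forall i, (a == b %[mod (p i ^ (e i - y i))%N])%Z].
Proof.
move=> ye; have n_split : n = (\prod_(i < s) p i ^ (e i - y i) * \prod_(i < s) p i ^ y i)%N.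
  by rewrite nE -big_split /=; apply: eq_bigr => i _; rewrite -expnD subnK.
rewrite eqz_mod_dvd -mulrBl {1}n_split PoszM dvdz_mul2r; last first.
  by rewrite eqz_nat -lt0n prodn_gt0 // => i; apply: prime_power_gt0.
rewrite -eqz_mod_dvd; apply/idP/forallP => [/eqP ab i|ab].
  apply/eqP/(eqmodz_dvd _ ab); rewrite dvdzE /= (bigD1 i) //= dvdn_mulr //.
apply/eqP/eqmodz_prod => [i j ij|i]; [exact: coprime_prime_powers|exact/eqP].
Qed.

Lemma eta_yxE (yx : yxindex s n) : eta_yx p eta yx =
  (\prod_(i < s) eta i ^+ xpart yx i) * (\prod_(i < s) p i ^ ypart yx i)%N.
Proof.
rewrite /eta_yx; congr (_ * _); rewrite (big_morph Posz PoszM (erefl _)).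
by apply: eq_bigr => i _; rewrite PoszX.
Qed.

Lemma SigmaP (yx : yxindex s n) : yx \in Sigma p e q n ->
  forall i, (ypart yx i <= e i)%N /\ (xpart yx i < gdeg p e q (ypart yx) i *
    gcdn (\big[lcmn/1%N]_(j < s | (j < i)%N) fdeg p e q (ypart yx) j)
         (fdeg p e q (ypart yx) i))%N.
Proof. by rewrite inE => /forallP H i; have /andP[] := H i. Qed.

(** The same j must serve all primes. Induction on the number of primes already treated: at a new
    prime, j is changed only by multiples of the lcm l of the earlier orders, which preserves the
    earlier congruences. *)
Lemma unit_repr (y : 'I_s -> nat) (w : int) :
    (forall i, coprimez w (p i ^ (e i - y i))%N) ->
  exists x j, forall i : 'I_s, (x i < gdeg p e q y i *
    gcdn (\big[lcmn/1%N]_(j < s | (j < i)%N) fdeg p e q y j) (fdeg p e q y i))%N /\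
    (w = eta i ^+ x i * q%:Z ^+ j %[mod (p i ^ (e i - y i))%N])%Z.
Proof.
move=> cow; suff : forall k, exists (x : 'I_s -> nat) j, forall i : 'I_s, (i < k)%N ->
    (x i < gdeg p e q y i *
    gcdn (\big[lcmn/1%N]_(j < s | (j < i)%N) fdeg p e q y j) (fdeg p e q y i))%N /\
    (w = eta i ^+ x i * q%:Z ^+ j %[mod (p i ^ (e i - y i))%N])%Z.
  by case/(_ s) => x [j xj]; exists x, j => i; apply: xj (ltn_ord i).
elim=> [|k [x [j xj]]]; first by exists (fun=> 0%N), 0%N.
case: (ltnP k s) => [ks|sk]; last first.
  by exists x, j => i _; apply: xj; apply: leq_trans sk.
pose i0 := Ordinal ks; pose l := \big[lcmn/1%N]_(j < s | (j < i0)%N) fdeg p e q y j.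
have l_gt0 : (0 < l)%N.
  by apply: (big_ind (leq 1)) => // a b a0 b0; rewrite lcmn_gt0 a0.
have coq i r : coprimez (q%:Z ^+ r) (p i ^ (e i - y i))%N.
  exact/coprimezXl/coprime_q_prime_power.
(* With b inverse to q^j, representing w b as eta_i^x0 q^(l r) gives w as eta_i^x0 q^(j + l r). *)
have [b jb] := coprimez_inv (coq i0 j).
have cob : coprimez b (p i0 ^ (e i0 - y i0))%N.
  have : coprimez (q%:Z ^+ j * b) (p i0 ^ (e i0 - y i0))%N.
    by rewrite (eqmodz_coprime jb) /coprimez gcd1z.
  by rewrite coprimezMl => /andP[].
have [|x0 [r [lt_x0 x0E]]] := primitive_root_repr (prime_power_gt0 _ _)
    (eta_primitive_root y i0) l_gt0 (coprime_q_prime_power i0 _) (_ : coprimez (w * b) _).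
  by rewrite coprimezMl cow.
exists (fun i => if i == i0 then x0 else x i), (j + l * r)%N => i; rewrite ltnS leq_eqVlt.
case: (eqVneq i i0) => [-> _|ii0 /orP[/eqP ik|ik]]; last 2 first.
- by case/eqP: ii0; apply: val_inj.
- have [xi wE] := xj i ik; split=> //; rewrite exprD mulrA wE.
  rewrite -[in LHS](mulr1 (_ * _)); apply: eqmodzM => //; symmetry; apply/eqP.
  rewrite mord_dvd ?prime_power_gt0 ?coprime_q_prime_power // dvdn_mulr //.
  exact: (@biglcmn_sup _ i).
split=> //; rewrite addnC exprD mulrA -(mulr1 w).
rewrite -(modzMmr w) -jb modzMmr mulrCA mulrC; exact: eqmodzM.
Qed.

Lemma Sigma_repr (z : int) : exists2 yx : yxindex s n, yx \in Sigma p e q n &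
  exists j, (z = eta_yx p eta yx * q%:Z ^+ j %[mod n])%Z.
Proof.
have n_gt0 : (0 < n)%N by rewrite nE prodn_gt0 // => i; apply: prime_power_gt0.
(* Taking the valuations of gcd(z, n) rather than of z caps them at e_i, and gives y = e when z =
   0. *)
pose G := gcdn `|z| n; have G0 : (0 < G)%N by rewrite gcdn_gt0 n_gt0 orbT.
pose y i := logn (p i) G.
have ye i : (y i <= e i)%N.
  by rewrite -(logn_primes_prod e i) -nE dvdn_leq_log // dvdn_gcdr.
have YG : (\prod_(i < s) p i ^ y i %| G)%N.
  apply: dvdn_prod_coprime => [i j|i]; first exact: coprime_prime_powers.
  by rewrite pfactor_dvdn.
have /dvdzP[w zE] : ((\prod_(i < s) p i ^ y i)%N %| z)%Z.
  by rewrite dvdzE /=; apply: dvdn_trans YG (dvdn_gcdl _ _).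
have cow i : coprimez w (p i ^ (e i - y i))%N.
  case: (posnP (e i - y i)) => [->|]; first by rewrite /coprimez gcdzC gcd1z.
  rewrite subn_gt0 => lt_ye; apply: (@coprimeXr _ `|w| (p i)).
  rewrite coprime_sym prime_coprime //; apply/negP => pw.
  have : (p i ^ (y i).+1 %| G)%N.
    rewrite dvdn_gcd prime_power_dvd_n // zE abszM expnS dvdn_mul //=.
    by rewrite (bigD1 i) //= dvdn_mulr.
  by rewrite pfactor_dvdn // ltnn.
have [x [j xj]] := unit_repr cow.
have Syx : in_Sigma p e q y x by apply/forallP => i; rewrite ye; case: (xj i).
have bound i := in_Sigma_bound nE p_prime Syx i.
pose yx : yxindex s n := ([ffun i => inord (y i)], [ffun i => inord (x i)]).
have yE : ypart yx =1 y.
  by move=> i; rewrite /ypart ffunE inordK //; case: (bound i).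
have xE : xpart yx =1 x.
  by move=> i; rewrite /xpart ffunE inordK //; case: (bound i).
have yE' : (\prod_(i < s) p i ^ ypart yx i = \prod_(i < s) p i ^ y i)%N.
  by apply: eq_bigr => i _; rewrite yE.
exists yx.
  rewrite inE; apply/forallP => i; rewrite yE xE ye.
  have [+ _] := xj i; rewrite /gdeg /fdeg yE; congr is_true; congr (_ < _ * gcdn _ _)%N.
  by apply: eq_bigr => k _; rewrite yE.
exists j; rewrite eta_yxE zE yE' mulrAC; apply/eqP; rewrite eqmodz_cofactor //.
apply/forallP => i; have [_ ->] := xj i; apply/eqP/eqmodzM => //.
rewrite (eq_bigr (fun i => eta i ^+ x i)) => [|k _]; last by rewrite xE.
by rewrite eta_x_mod // leq_subr.
Qed.

(** The power of p_i on the right divides n as well, hence the left-hand side, whose factor in eta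
    is prime to p_i. *)
Lemma eqmod_ypart_leq (yx yx' : yxindex s n) j i : (ypart yx' i <= e i)%N ->
  (eta_yx p eta yx = eta_yx p eta yx' * q%:Z ^+ j %[mod n])%Z ->
  (ypart yx' i <= ypart yx i)%N.
Proof.
move=> ye; rewrite !eta_yxE; set y' := ypart yx' i => H.
have : ((p i ^ y')%N %| eta_x eta yx * (\prod_(i < s) p i ^ ypart yx i)%N)%Z.
  have dn : ((p i ^ y')%N %| n%:Z)%Z by rewrite dvdzE prime_power_dvd_n.
  apply/dvdz_mod0P; rewrite (eqmodz_dvd dn H); apply/dvdz_mod0P.
  by rewrite mulrAC dvdz_mull // dvdzE /= (bigD1 i) //= dvdn_mulr.
rewrite Gauss_dvdzr 1?coprimez_sym ?eta_x_coprime // dvdzE /=.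
rewrite pfactor_dvdn ?logn_primes_prod // prodn_gt0 // => k; exact: prime_power_gt0.
Qed.

(** Divisibility in both directions gives equal y. For x, the induction over the primes also carries
    that the orders f_r already met divide j: then j is a multiple of their lcm, the bound of
    [Sigma] forces x_i = x'_i, and cancelling gives that f_i divides j too. *)
Lemma Sigma_inj (yx yx' : yxindex s n) j :
    yx \in Sigma p e q n -> yx' \in Sigma p e q n ->
  (eta_yx p eta yx = eta_yx p eta yx' * q%:Z ^+ j %[mod n])%Z -> yx = yx'.
Proof.
move=> /SigmaP S1 /SigmaP S2 H.
have n_gt0 : (0 < n)%N by rewrite nE prodn_gt0 // => i; apply: prime_power_gt0.
have yE i : ypart yx i = ypart yx' i.
  have [k H'] := coset_sym n_gt0 co_qn H.
  have [le1 _] := S1 i; have [le2 _] := S2 i.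
  by apply/eqP; rewrite eqn_leq (eqmod_ypart_leq le2 H) (eqmod_ypart_leq le1 H').
have ye i : (ypart yx i <= e i)%N by case: (S1 i).
have yE' : (\prod_(i < s) p i ^ ypart yx' i = \prod_(i < s) p i ^ ypart yx i)%N.
  by apply: eq_bigr => i _; rewrite yE.
move/eqP: H; rewrite !eta_yxE yE' mulrAC eqmodz_cofactor // => /forallP H.
have Hi i : (eta i ^+ xpart yx i = eta i ^+ xpart yx' i * q%:Z ^+ j
    %[mod (p i ^ (e i - ypart yx i))%N])%Z.
  rewrite -(eta_x_mod (xpart yx) (leq_subr _ _)) (eqP (H i)).
  by apply: eqmodzM => //; rewrite eta_x_mod // leq_subr.
have coq i := coprime_q_prime_power i (e i - ypart yx i).
suff K k : forall i : 'I_s, (i < k)%N -> xpart yx i = xpart yx' i /\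
    (fdeg p e q (ypart yx) i %| j)%N.
  have {K}xE i : xpart yx i = xpart yx' i by case: (K s i (ltn_ord i)).
  case: yx yx' yE xE {S1 S2 ye yE' H Hi coq} => y x [y' x'] yE xE.
  by congr pair; apply/ffunP => i; apply: val_inj; [apply: yE|apply: xE].
elim: k => // k IH i; rewrite ltnS leq_eqVlt => /orP[/eqP ik|]; last exact: IH.
have Qi0 := prime_power_gt0 i (e i - ypart yx i).
have pr := eta_primitive_root (ypart yx) i.
have xE : xpart yx i = xpart yx' i.
  have [_ x1] := S1 i; have [_ x2] := S2 i.
  set l := (\big[lcmn/1%N]_(j < s | (j < i)%N) fdeg p e q (ypart yx) j) in x1.
  have lj : (l %| j)%N.
    by apply/dvdn_biglcmP => r ri; rewrite ik in ri; case: (IH r ri).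
  have := Hi i; rewrite -(divnK lj) mulnC.
  apply: (primitive_root_repr_inj Qi0 pr) => //.
  move: x2; rewrite /gdeg /fdeg -yE; congr is_true; congr (_ < _ * gcdn _ _)%N.
  by apply: eq_bigr => r _; rewrite /fdeg yE.
split=> //; rewrite -mord_dvd //; apply/eqP.
apply: (@eqmodz_cancel _ _ _ (eta i ^+ xpart yx i)).
  by apply: coprimezXl; case: pr.
by rewrite mulr1 {1}xE -Hi.
Qed.

End CosetRepresentatives.

(** * Lifting congruences to prime powers, and the 2-part of the order of q *)

Lemma eqmodz_expp (p k : nat) (x y : int) : (0 < k)%N ->
  (x = y %[mod (p ^ k)%N])%Z -> (x ^+ p = y ^+ p %[mod (p ^ k.+1)%N])%Z.
Proof.
(* The cofactor of x - y in x^p - y^p has p terms, all congruent to y^(p-1) modulo p, so it supplies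
   one more factor p. *)
move=> k0 xy; apply/eqP; rewrite eqz_mod_dvd subrXX expnSr PoszM dvdz_mul //.
  by rewrite -eqz_mod_dvd xy.
have xyp : (x = y %[mod p])%Z.
  by apply: eqmodz_dvd xy; rewrite dvdzE /= dvdn_exp.
rewrite -[X in (_ %| X)%Z]subr0 -eqz_mod_dvd.
have -> : (0 = \sum_(i < p) y ^+ p.-1 %[mod p])%Z.
  by rewrite sumr_const card_ord -mulr_natl natz modzMr mod0z.
apply/eqP; apply: (big_ind2 (fun a b : int => (a = b %[mod p])%Z)) => // [a b c d ab cd|i _].
  by rewrite -modzDm ab cd modzDm.
have -> : y ^+ p.-1 = y ^+ (p.-1 - i) * y ^+ i.
  by rewrite -exprD subnK // -ltnS prednK // (leq_trans _ (ltn_ord i)).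
by apply: eqmodzM; apply: eqmodzX.
Qed.

Lemma eqmodz_expX (p k : nat) (x y : int) :
  (x = y %[mod p])%Z -> (x ^+ (p ^ k) = y ^+ (p ^ k) %[mod (p ^ k.+1)%N])%Z.
Proof.
move=> xy; elim: k => [|k IH]; first by rewrite expn0 !expr1 expn1.
by rewrite (expnSr p k) !exprM; apply: eqmodz_expp.
Qed.

(** Here a^h is a square root of 1 other than 1, and p is prime. *)
Lemma half_order_m1 (p h : nat) (a : int) : prime p -> coprimez a p ->
  mord p a = (h * 2)%N -> (a ^+ h = -1 %[mod p])%Z.
Proof.
move=> pp co oE; have p0 := prime_gt0 pp.
have h0 : (0 < h)%N by have := mord_gt0 p a; rewrite oE muln_gt0 => /andP[].
have /eqP : (a ^+ (h * 2) == 1 %[mod p])%Z by rewrite mord_dvd // oE.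
have : (a ^+ h == 1 %[mod p])%Z = false.
  by rewrite mord_dvd // oE gtnNdvd // -{1}[h]muln1 ltn_pmul2l.
rewrite exprM => neq /eqP; rewrite !eqz_mod_dvd subr_sqr_1 in neq * => H.
have := H; rewrite dvdzE abszM Euclid_dvdM // -!(dvdzE p%:Z) neq /= => pd.
by apply/eqP; rewrite eqz_mod_dvd opprK.
Qed.

(** The order divides 2j but, since 1 and -1 differ modulo p, not j; so the quotient of 2j by the
    order is odd. *)
Lemma logn2_order (p j : nat) (a : int) : prime p -> odd p -> coprimez a p ->
  (a ^+ j = -1 %[mod p])%Z -> logn 2 (mord p a) = (logn 2 j).+1.
Proof.
move=> pp op co aj; have p0 := prime_gt0 pp.
have nd : (mord p a %| j)%N = false.
  rewrite -mord_dvd // aj eq_sym eqz_mod_dvd opprK dvdzE /=.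
  rewrite dvdn_prime2 //; by apply/eqP => p2; rewrite p2 in op.
have j0 : (0 < j)%N by case: j nd {aj} => //; rewrite dvdn0.
have /dvdnP[c cE] : (mord p a %| j * 2)%N.
  by rewrite -mord_dvd // exprM -modzXm aj modzXm sqrrN expr1n.
have oc : odd c.
  apply: contraFT nd => /even_halfK cE'; rewrite -cE' -muln2 mulnAC in cE.
  move/eqP: cE; rewrite eqn_pmul2r // => /eqP ->; exact: dvdn_mull.
have c0 : (0 < c)%N by case: (c) oc.
have := congr1 (logn 2) cE; rewrite !lognM ?mord_gt0 // (logn_coprime (m := c)) ?coprime2n //.
by rewrite add0n addn1 => <-.
Qed.

(** * Cosets equal to their opposite *)

Section SelfOpposite.

Variables (s q n : nat) (p e : 'I_s -> nat) (eta : 'I_s -> int).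
Hypotheses (p_prime : forall i, prime (p i)) (p_odd : forall i, odd (p i)).
Hypotheses (p_inj : injective p) (e_gt0 : forall i, (0 < e i)%N).
Hypotheses (nE : n = (\prod_(i < s) p i ^ e i)%N) (co_qn : coprime q n).
Hypothesis eta_root : primitive_root_system p e eta.
Variables (t : nat) (sg : nat -> nat).
Hypothesis hsg : grouping p q t sg.

Lemma n_odd : odd n.
Proof.
rewrite nE; apply: (big_ind odd) => // [a b oa ob|i _]; first by rewrite oddM oa.
by rewrite oddX p_odd orbT.
Qed.

Let coq i : coprimez q%:Z (p i).
Proof. by have := coprime_q_prime_power e_gt0 nE co_qn i 1; rewrite expn1. Qed.

(** The factor in eta is a unit and cancels, so the condition depends on y alone; where y_i = e_i
    the modulus is 1 and nothing is asked. *)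
Let opp_classE (yx : yxindex s n) : yx \in Sigma p e q n ->
  opp_class p q eta yx yx <->
  exists j, forall i, (q%:Z ^+ j = -1 %[mod (p i ^ (e i - ypart yx i))%N])%Z.
Proof.
move=> /SigmaP S; have ye i : (ypart yx i <= e i)%N by case: (S i).
rewrite /opp_class (eta_yxE p eta yx); set E := \prod_(i < s) _.
have EE j i : (- E == E * q%:Z ^+ j %[mod (p i ^ (e i - ypart yx i))%N])%Z =
    (q%:Z ^+ j == -1 %[mod (p i ^ (e i - ypart yx i))%N])%Z.
  have coE : coprimez E (p i ^ (e i - ypart yx i))%N.
    exact: (eta_x_coprime e_gt0 eta_root).
  rewrite eq_sym -(mulrN1 E); apply/eqP/eqP => [|qj]; last exact: eqmodzM.
  exact: eqmodz_cancel.
have EE' j : (- (E * (\prod_(i < s) p i ^ ypart yx i)%N) ==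
     E * (\prod_(i < s) p i ^ ypart yx i)%N * q%:Z ^+ j %[mod n])%Z =
  [forall i, (q%:Z ^+ j == -1 %[mod (p i ^ (e i - ypart yx i))%N])%Z].
  rewrite -mulNr mulrAC (eqmodz_cofactor p_prime p_inj nE) //.
  by apply: eq_forallb => i; rewrite EE.
split=> -[j] jE; exists j.
  by move/eqP: jE; rewrite EE' => /forallP H i; apply/eqP.
by apply/eqP; rewrite EE'; apply/forallP => i; apply/eqP.
Qed.

Lemma Sigma_k_opp (k : nat) (yx : yxindex s n) : (2 <= k <= t)%N ->
  yx \in Sigma_k p e q n sg k -> opp_class p q eta yx yx.
Proof.
move=> /andP[k2 kt]; rewrite inE => /andP[S /forallP ing].
have [[t0 sg0] sgt mono v2_0 v2E] := hsg.
have k0 : (0 < k)%N by apply: leq_trans k2.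
apply/(opp_classE S); pose o i := mord (p i) q.
pose J := (\prod_(i < s | in_group sg k i) (o i)`_2^')%N.
(* The common valuation of the orders in the group is positive: odd orders only occur at indices
   below [sg 1], and [sg 1] is at most [sg k.-1] because k >= 2. *)
have [w wE] : exists w, forall i : 'I_s, in_group sg k i -> v2ord p q i = w.+1.
  case: (pickP (fun i : 'I_s => in_group sg k i)) => [i0 gi0|no]; last first.
    by exists 0%N => i; rewrite no.
  exists (v2ord p q i0).-1 => i gi; have := v2E k k i i0; rewrite eqxx k0 leqnn => -> //.
  rewrite prednK // lt0n v2_0 -leqNgt; have /andP[le_k _] := gi0.
  apply: leq_trans le_k; have : (0 < k.-1)%N by rewrite -ltnS prednK.
  have : (k.-1 < t)%N by rewrite prednK.
  elim: (k.-1) => // -[|l] // IH lt _; apply: leq_trans (ltnW (mono l.+1 (ltnW lt))).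
  by apply: IH => //; apply: ltnW.
(* q ^ (2 ^ w * J) is - 1 modulo the p_i of the group; the odd exponent n lifts
   this to their powers. *)
exists (2 ^ w * J * n)%N => i; case: (boolP (in_group sg k i)) => [gi|]; last first.
  move=> ngi; have := ing i; rewrite (negbTE ngi) => /= /eqP ->.
  by apply/eqP; rewrite subnn expn0 eqz_mod_dvd dvdzE dvd1n.
have oi : o i = (2 ^ w * (o i)`_2^' * 2)%N.
  by rewrite mulnAC -expnSr -(wE i gi) -p_part partnC ?mord_gt0.
rewrite exprM /J (bigD1 i) //= mulnA.
(* For the given i, h is half the order of q modulo p_i, and the odd parts of the other orders make
   up the odd exponent c. *)
set h := (2 ^ w * _)%N in oi *; rewrite exprM.
set c := (\prod_(_ < s | _) _)%N; have oc : odd c.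
  apply: (big_ind odd) => // [a b oa ob|r _]; first by rewrite oddM oa.
  by rewrite odd_2'nat part_pnat.
have c1 : (q%:Z ^+ h ^+ c = -1 %[mod p i])%Z.
  rewrite (eqmodzX _ (half_order_m1 (p_prime i) (coq i) oi)).
  by rewrite -signr_odd oc expr1.
have {}c1 : (q%:Z ^+ h ^+ c ^+ (p i ^ e i) = -1
    %[mod (p i ^ (e i - ypart yx i))%N])%Z.
  apply: (@eqmodz_dvd _ (p i ^ (e i).+1)%N).
    by rewrite dvdzE /= dvdn_exp2l // (leq_trans (leq_subr _ _)).
  by rewrite (eqmodz_expX _ c1) -signr_odd oddX p_odd orbT expr1.
have [r nr] : exists r, n = (p i ^ e i * r)%N.
  by exists (\prod_(k < s | k != i) p k ^ e k)%N; rewrite nE (bigD1 i).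
have or : odd r by have := n_odd; rewrite {1}nr oddM => /andP[].
rewrite [X in _ ^+ X]nr exprM.
by rewrite (eqmodzX _ c1) -signr_odd or expr1.
Qed.

Lemma Sigma'_opp (yx : yxindex s n) :
  yx \in Sigma' p e q n t sg -> opp_class p q eta yx yx.
Proof.
rewrite /Sigma' big_seq; elim/big_ind: _ => [|A B HA HB|k]; first by rewrite inE.
  by rewrite inE => /orP[/HA|/HB].
by rewrite mem_index_iota ltnS => /Sigma_k_opp H /H.
Qed.

Lemma Sigma_0_opp (yx : yxindex s n) :
  yx \in Sigma_0 p e q n -> opp_class p q eta yx yx.
Proof.
rewrite inE => /andP[S /forallP ye]; apply/(opp_classE S); exists 0%N => i.
by apply/eqP; rewrite (eqP (ye i)) subnn expn0 eqz_mod_dvd dvdzE dvd1n.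
Qed.

Lemma opp_class_self (yx : yxindex s n) : yx \in Sigma p e q n ->
  opp_class p q eta yx yx -> yx \in Sigma_0 p e q n :|: Sigma' p e q n t sg.
Proof.
move=> S /(opp_classE S)[j jE]; rewrite in_setU inE S.
case: forallP => //= no0; have [[t0 sg0] sgt mono v2_0 v2E] := hsg.
have v2j (i : 'I_s) : ypart yx i != e i -> v2ord p q i = (logn 2 j).+1.
  move=> yei; apply: logn2_order => //; apply: (eqmodz_dvd _ (jE i)).
  have /(SigmaP)/(_ i)[le_ye _] := S.
  by rewrite dvdzE /= dvdn_exp // subn_gt0 ltn_neqAle yei.
(* Take the least k with i < [sg k]: minimality gives the lower end of the group, and [sg 0] = 0
   excludes k = 0. *)
have group_of (i : 'I_s) : exists2 k, (0 < k <= t)%N & in_group sg k i.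
  have ex : exists k, (i < sg k)%N by exists t; rewrite sgt.
  case: (ex_minnP ex) => k ik least; exists k.
    rewrite least ?sgt // andbT lt0n; apply: contraL ik => /eqP ->.
    by rewrite sg0.
  rewrite /in_group ik andbT leqNgt; apply: contraL ik => /least.
  case: (k) => [|k']; last by rewrite ltnn.
  by rewrite sg0.
have /existsP[i0 yi0] : [exists i, ypart yx i != e i].
  by rewrite -negb_forall; apply/forallP.
have [k /andP[k0 kt] gi0] := group_of i0.
(* The first group consists of odd orders, whereas the valuation found here is a successor. *)
have k2 : (2 <= k)%N.
  rewrite ltn_neqAle k0 andbT; apply/eqP => k1; move: gi0; rewrite -k1 /in_group.
  by rewrite -v2_0 v2j // andbF.
rewrite /Sigma' (big_cat_nat (n := k)) //= ?(leqW kt) // in_setU; apply/orP; right.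
rewrite big_ltn // in_setU; apply/orP; left; rewrite inE S; apply/forallP => i /=.
case: (eqVneq (ypart yx i) (e i)) => [_|yi]; first by rewrite orbT.
have [l /andP[l0 lt] gi] := group_of i; rewrite orbF.
have := v2E k l i0 i; have := v2E l k i i0; rewrite !v2j //  k0 l0 kt lt /= => W1 W2.
case: (ltngtP k l) W1 W2 => [kl|lk|-> //].
  by move=> _ /(_ isT isT gi0 gi); rewrite ltnn.
by move=> /(_ isT isT gi gi0); rewrite ltnn.
Qed.

End SelfOpposite.

(** * Expansion of the coset polynomials *)

Lemma geometric_sum_mod (d x k : nat) :
  (x = 1 %[mod d] -> \sum_(i < k) x ^ i = k %[mod d])%N.
Proof.
move=> x1; elim: k => [|k IH]; first by rewrite big_ord0.
rewrite big_ord_recr /= -modnDm IH -modnXm x1 modnXm exp1n modnDm addn1 //.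
Qed.

(** Modulo p^2 the i-th power of 1 + u p is 1 + i u p, so the sum is p + u p C(p,2), which is p
    modulo p^2: an odd p divides C(p,2). *)
Lemma logn_geometric_sum (p x : nat) : prime p -> odd p -> (x = 1 %[mod p])%N ->
  logn p (\sum_(i < p) x ^ i)%N = 1%N.
Proof.
move=> pp po x1; have p0 := prime_gt0 pp; have p1 := prime_gt1 pp.
case: x x1 => [|x x1]; first by rewrite mod0n modn_small.
have /dvdnP[u xE] : (p %| x)%N.
  by move/eqP: x1; rewrite eqn_mod_dvd // subn1.
have powE i : (x.+1 ^ i = 1 + i * x %[mod p ^ 2])%N.
  elim: i => [|i IH]; first by rewrite mul0n.
  rewrite expnSr -modnMml IH modnMml.
  have -> : ((1 + i * x) * x.+1 = i * u ^ 2 * p ^ 2 + (1 + i.+1 * x))%N.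
    by rewrite -mulnA -expnMn -xE; ring.
  by rewrite modnMDl.
have sumE : (\sum_(i < p) x.+1 ^ i = p %[mod p ^ 2])%N.
  have -> : (\sum_(i < p) x.+1 ^ i = \sum_(i < p) (1 + i * x) %[mod p ^ 2])%N.
    apply: (big_ind2 (fun a b => a = b %[mod p ^ 2])%N) => // a b c d ab cd.
    by rewrite -modnDm ab cd modnDm.
  rewrite big_split /= sum1_card card_ord -big_distrl /= -(big_mkord xpredT id) bin2_sum.
  have /dvdnP[c ->] : (p %| 'C(p, 2))%N.
    by rewrite prime_dvd_bin //= ltn_neqAle p1 andbT; apply: contraL po => /eqP <-.
  have -> : (p + c * p * x = c * u * p ^ 2 + p)%N by rewrite xE; ring.
  by rewrite modnMDl.
set S := (\sum_(i < p) _)%N in sumE *.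
have S0 : (0 < S)%N.
  case: (posnP S) sumE => // -> /eqP; rewrite mod0n eq_sym modn_small ?gtn_eqF //.
  by rewrite expnS expn1 -{1}(muln1 p) ltn_pmul2l.
have pS : (p ^ 1 %| S)%N.
  have d1 : (p %| p ^ 2)%N by rewrite dvdn_exp.
  by rewrite expn1 /dvdn -(modn_dvdm S d1) sumE (modn_dvdm _ d1) modnn.
have pS' : ~~ (p ^ 2 %| S)%N.
  rewrite /dvdn sumE modn_small ?lt0n_neq0 //.
  by rewrite expnS expn1 -{1}(muln1 p) ltn_pmul2l.
by move: pS pS'; rewrite !pfactor_dvdn // => a b; apply/eqP; rewrite eqn_leq a leqNgt b.
Qed.

(** Lifting the exponent, by strong induction on k. If k = c p, the geometric sum in x^c adds
    exactly one to the valuation; if p does not divide k, the geometric sum in x is k modulo p, a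
    unit. *)
Lemma logn_expn_sub1 (p x k : nat) : prime p -> odd p -> (1 < x)%N -> (0 < k)%N ->
  (p %| x - 1)%N -> logn p (x ^ k - 1) = (logn p (x - 1) + logn p k)%N.
Proof.
move=> pp po x1 k0 px; have p0 := prime_gt0 pp.
have [m] := ubnP k; elim: m k k0 => // m IH k k0 km.
have sub_gt0 j : (0 < j)%N -> (0 < x ^ j - 1)%N.
  by move=> j0; rewrite subn_gt0 -(exp1n j) ltn_exp2r.
have one j : (x ^ j = 1 %[mod p])%N.
  have /eqP xm : (x == 1 %[mod p])%N by rewrite eqn_mod_dvd // ltnW.
  by rewrite -modnXm xm modnXm exp1n.
case: (boolP (p %| k)%N) => [/dvdnP[c kE]|npk].
  have c0 : (0 < c)%N by move: k0; rewrite kE muln_gt0 => /andP[].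
  have ck : (c < k)%N by rewrite kE -{1}(muln1 c) ltn_pmul2l // prime_gt1.
  rewrite kE expnM subn1 predn_exp -subn1 lognM ?sub_gt0 //; last first.
    by case: (p) p0 => // p' _; rewrite big_ord_recl expn0.
  rewrite IH ?(leq_trans ck) // logn_geometric_sum // lognM // (logn_prime p pp) eqxx.
  by rewrite addnA.
rewrite subn1 predn_exp -subn1 lognM ?subn_gt0 //; last first.
  by case: (k) k0 => // k' _; rewrite big_ord_recl expn0.
congr (_ + _)%N; rewrite !(@logn_coprime p) // prime_coprime //.
by rewrite /dvdn (geometric_sum_mod k (etrans (esym (congr1 (modn^~ p) (expn1 x))) (one 1%N))).
Qed.

Lemma prim_exprz_eq (L : fieldType) (N : nat) (z : L) (a b : int) :
  N.-primitive_root z -> (z ^ a == z ^ b) = (a == b %[mod N])%Z.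
Proof.
move=> pr; have N0 := prim_order_gt0 pr; have Nn0 : N%:Z != 0 by rewrite eqz_nat -lt0n.
have z_unit : z \is a GRing.unit.
  rewrite unitfE; apply/eqP => z0; have := prim_expr_order pr.
  by rewrite z0 expr0n gtn_eqF // => /eqP; rewrite eq_sym oner_eq0.
have red c : z ^ c = z ^+ `|(c %% N)%Z|.
  rewrite {1}(divz_eq c N) [(_ %/ _)%Z * _]mulrC exprzDr // -exprz_exp.
  rewrite -exprnP (prim_expr_order pr) exp1rz mul1r -{1}[(c %% N)%Z]gez0_abs ?modz_ge0 //.
rewrite !red (eq_prim_root_expr pr) -eqz_nat -!modz_nat !gez0_abs ?modz_ge0 //.
by rewrite !modz_mod.
Qed.

Section CosetPolynomialExpansion.

Variables (s q n : nat) (p e : 'I_s -> nat) (eta : 'I_s -> int).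
Hypotheses (p_prime : forall i, prime (p i)) (p_odd : forall i, odd (p i)).
Hypotheses (p_inj : injective p) (e_gt0 : forall i, (0 < e i)%N).
Hypotheses (nE : n = (\prod_(i < s) p i ^ e i)%N) (co_qn : coprime q n).
Hypothesis q_gt1 : (1 < q)%N.
Hypothesis eta_root : primitive_root_system p e eta.
Variables (L : fieldType) (zeta : nat -> L).
Hypothesis zetaP : compatible_roots zeta q.

Variable yx : yxindex s n.
Hypothesis yx_Sigma : yx \in Sigma p e q n.

Let y := ypart yx.
Let w : int := - eta_x eta yx.
Let om := omega p e q yx.
Let M := Mexp p e q yx.
(** The factor of [eta_yx] in the p_i reduces zeta_n to zeta_n'. Then n' = N D, where the order of q
    modulo N divides [om] and D is absorbed by the substitution of X^D. *)
Let n' := (\prod_(i < s) p i ^ (e i - y i))%N.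
Let N := (\prod_(i < s) p i ^ (e i - y i - M i))%N.
Let D := (\prod_(i < s) p i ^ M i)%N.
Let tau := coset_size n q (- eta_yx p eta yx).

Let ye i : (y i <= e i)%N. Proof. by case: (SigmaP yx_Sigma i). Qed.

Let n'_gt0 : (0 < n')%N. Proof. by rewrite prodn_gt0 // => i; apply: prime_power_gt0. Qed.
Let n_gt0 : (0 < n)%N. Proof. by rewrite nE prodn_gt0 // => i; apply: prime_power_gt0. Qed.
Let N_gt0 : (0 < N)%N. Proof. by rewrite prodn_gt0 // => i; apply: prime_power_gt0. Qed.
Let D_gt0 : (0 < D)%N. Proof. by rewrite prodn_gt0 // => i; apply: prime_power_gt0. Qed.
Let om_gt0 : (0 < om)%N.
Proof. by apply: (big_ind (leq 1)) => // a b a0 b0; rewrite lcmn_gt0 a0. Qed.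

Let n'E : n' = (N * D)%N.
Proof. by rewrite -big_split /=; apply: eq_bigr => i _; rewrite -expnD subnK // leq_subr. Qed.

Let n_split : n = (n' * \prod_(i < s) p i ^ y i)%N.
Proof. by rewrite nE -big_split /=; apply: eq_bigr => i _; rewrite -expnD subnK. Qed.

Let co_n' : coprime n' q.
Proof. by rewrite coprime_sym; apply: coprime_dvdr co_qn; rewrite n_split dvdn_mulr. Qed.

Let co_N : coprime N q.
Proof. by apply: coprime_dvdl co_n'; rewrite n'E dvdn_mulr. Qed.

Let gammaE j : - eta_yx p eta yx * q%:Z ^+ j =
  w * q%:Z ^+ j * (\prod_(i < s) p i ^ y i)%N.
Proof. by rewrite eta_yxE -mulNr mulrAC. Qed.

Let q_pow_sub1_gt0 j : (0 < j)%N -> (0 < q ^ j - 1)%N.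
Proof. by move=> j0; rewrite subn_gt0 -(exp1n j) ltn_exp2r. Qed.

Let eqmod_pow i d j : (0 < j)%N ->
  (q%:Z ^+ j == 1 %[mod (p i ^ d)%N])%Z = (d <= logn (p i) (q ^ j - 1))%N.
Proof.
move=> j0; rewrite eqz_mod_dvd -PoszX -(pfactor_dvdn _ (p_prime i)) ?q_pow_sub1_gt0 //.
by rewrite (_ : _ - 1 = (q ^ j - 1)%N%:Z) // -subzn // expn_gt0 ltnW.
Qed.

Let prime_dvd_om i : (y i < e i)%N -> (p i %| q ^ om - 1)%N.
Proof.
move=> yi; rewrite -(expn1 (p i)) pfactor_dvdn ?q_pow_sub1_gt0 // -eqmod_pow //.
rewrite mord_dvd ?prime_power_gt0 ?(coprime_q_prime_power e_gt0 nE) //.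
rewrite /om /omega; apply: (@biglcmn_sup _ i) => //.
by rewrite (minn_idPr _) // subn_gt0.
Qed.

Let coset_size_cond j : (- eta_yx p eta yx * q%:Z ^+ j == - eta_yx p eta yx %[mod n])%Z =
  [forall i, (q%:Z ^+ j == 1 %[mod (p i ^ (e i - y i))%N])%Z].
Proof.
have := gammaE 0; rewrite expr0 !mulr1 => g0.
rewrite gammaE g0 (eqmodz_cofactor p_prime p_inj nE) //.
apply: eq_forallb => i; apply/eqP/eqP => [|qj]; last first.
  by rewrite -[in RHS](mulr1 w); apply: eqmodzM.
rewrite -[in X in _ = X](mulr1 w); apply: eqmodz_cancel.
by rewrite coprimeNz; apply: (eta_x_coprime e_gt0 eta_root).
Qed.

(** Since q^tau = 1 at every prime involved, tau = k om. By lifting the exponent, the valuation of k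
    at p_i must make up what q^om - 1 lacks, namely M_i, so D divides k. *)
Let leq_tau : (om * D <= tau)%N.
Proof.
have [/eqP + _] := coset_sizeP (- eta_yx p eta yx) n_gt0 co_qn.
rewrite coset_size_cond -/tau => /forallP tauP.
have /dvdnP[k tauE] : (om %| tau)%N.
  apply/dvdn_biglcmP => i _.
  rewrite -mord_dvd ?prime_power_gt0 ?(coprime_q_prime_power e_gt0 nE) //.
  apply/eqP/(eqmodz_dvd _ (eqP (tauP i))).
  by rewrite dvdzE /= dvdn_exp2l // geq_minl.
have k0 : (0 < k)%N by have : (0 < tau)%N by []; rewrite tauE muln_gt0 => /andP[].
rewrite tauE mulnC leq_pmul2r // dvdn_leq //.
apply: dvdn_prod_coprime => [i j|i]; first exact: coprime_prime_powers.
rewrite pfactor_dvdn //; case: (ltnP (y i) (e i)) => [yi|ei]; last first.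
  by rewrite /M /Mexp (eqP (ei : e i - y i == 0)%N).
have := tauP i; rewrite eqmod_pow // tauE mulnC expnM logn_expn_sub1 //.
- by rewrite leq_subLR addnA /M /Mexp -subnDA leq_subLR.
- by rewrite -(exp1n om) ltn_exp2r.
exact: prime_dvd_om.
Qed.

(** [Mexp] is the excess of e_i - y_i over the valuation of q^om - 1; the exponents in N are what is
    left without it. *)
Let q_om_N : (q%:Z ^+ om = 1 %[mod N])%Z.
Proof.
apply: eqmodz_prod => [i j|i]; first exact: coprime_prime_powers.
apply/eqP; rewrite eqmod_pow // leq_subLR addnC -leq_subLR //.
Qed.

Let rootsL := [seq zeta n' ^ (w * q%:Z ^+ j) | j <- iota 0 tau].

Let zn' : n'.-primitive_root (zeta n'). Proof. by case: zetaP => + _; apply. Qed.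
Let zN : N.-primitive_root (zeta N). Proof. by case: zetaP => + _; apply. Qed.

Let cosetpolyE : cosetpoly zeta n q (- eta_yx p eta yx) = \prod_(z <- rootsL) ('X - z%:P).
Proof.
rewrite big_map /cosetpoly -/tau -[iota 0 tau]/(index_iota 0 tau) big_mkord.
apply: eq_bigr => j _; rewrite gammaE [w * _ * _]mulrC -(exprz_exp (zeta n)) -exprnP.
have [_ zM] := zetaP; rewrite -(zM n' n) //; last 2 first.
- by rewrite coprime_sym.
- by rewrite [X in (_ %| X)%N]n_split dvdn_mulr.
by rewrite [X in (X %/ _)%N]n_split mulKn.
Qed.

Let uniq_rootsL : uniq rootsL.
Proof.
rewrite map_inj_in_uniq ?iota_uniq // => i j; rewrite !mem_iota !add0n.
wlog le_ij : i j / (i <= j)%N.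
  by move=> W; case: (leqP i j) => [|/ltnW] ij ii jj H; [apply: W|symmetry; apply: W].
move=> _ lt_j /eqP; rewrite (prim_exprz_eq _ _ zn') => /eqP ij.
case: (ltngtP i j) le_ij => // lt_ij _.
have [_ least] := coset_sizeP (- eta_yx p eta yx) n_gt0 co_qn.
suff : (tau <= j - i)%N by rewrite leqNgt (leq_ltn_trans (leq_subr _ _)).
apply: least; first by rewrite subn_gt0.
apply/eqP; rewrite coset_size_cond; apply/forallP => k; apply/eqP; symmetry.
apply: (@eqmodz_cancel _ _ _ (w * q%:Z ^+ i)).
  rewrite coprimezMl coprimeNz (eta_x_coprime e_gt0 eta_root).
  by apply/coprimezXl/(coprime_q_prime_power e_gt0 nE).
rewrite mulr1 -mulrA -exprD subnKC 1?ltnW //; apply: eqmodz_dvd ij.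
by rewrite dvdzE /n' /= (bigD1 k) //= dvdn_mulr.
Qed.

Let rootsR := [seq zeta N ^ (w * q%:Z ^+ u) | u <- iota 0 om].
Let P := \prod_(z <- rootsR) ('X - z%:P).

(** The D-th power of zeta_n' is zeta_N, on which the exponents w q^j only depend on j modulo
    [om]. *)
Let root_P_comp : all (root (P \Po 'X^D)) rootsL.
Proof.
apply/allP => _ /mapP[j _ ->]; rewrite root_comp hornerXn root_prod_XsubC.
apply/mapP; exists (j %% om)%N; first by rewrite mem_iota ltn_mod om_gt0.
have -> : (zeta n' ^ (w * q%:Z ^+ j)) ^+ D = zeta N ^ (w * q%:Z ^+ j).
  rewrite exprnP exprz_exp mulrC -(exprz_exp (zeta n')) -exprnP.
  have [_ zM] := zetaP; rewrite -(zM N n') //; last by rewrite n'E dvdn_mulr.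
  by rewrite [X in (X %/ _)%N]n'E mulKn.
apply/eqP; rewrite (prim_exprz_eq _ _ zN); apply/eqP/eqmodzM => //.
rewrite [in LHS](divn_eq j om) exprD mulnC exprM -[in RHS](mul1r (_ ^+ _)).
by apply: eqmodzM => //; rewrite (eqmodzX _ q_om_N) expr1n.
Qed.

(** The tau distinct roots of the left-hand side are roots of the right-hand side, of degree [om] D.
    Thus tau is at most [om] D, so by [leq_tau] equal to it, and two monic polynomials with the same
    simple roots and degree agree. *)
Lemma cosetpoly_comp : cosetpoly zeta n q (- eta_yx p eta yx) =
  (\prod_(u <- iota 0 om) ('X - (zeta N ^ (w * q%:Z ^+ u))%:P)) \Po 'X^D.
Proof.
rewrite cosetpolyE -(big_map (fun u => zeta N ^ (w * q%:Z ^+ u)) xpredT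
  (fun z => 'X - z%:P)) -/rootsR -/P.
have szX : (1 < size ('X^D : {poly L}))%N by rewrite size_polyXn ltnS.
have monP : P \is monic by apply: monic_prod_XsubC.
have monPc : lead_coef (P \Po 'X^D) = 1.
  by rewrite lead_coef_comp // lead_coefXn expr1n mulr1 (monicP monP).
have szP : size (P \Po 'X^D) = (om * D).+1.
  have := size_comp_poly P ('X^D).
  rewrite size_polyXn /= size_prod_XsubC size_map size_iota /=.
  move=> <-; rewrite prednK // size_poly_gt0 -lead_coef_eq0 monPc oner_eq0 //.
have tauE : tau = (om * D)%N.
  apply/eqP; rewrite eqn_leq leq_tau andbT -ltnS -szP.
  rewrite -[X in (X < _)%N](size_iota 0) -(size_map (fun j => zeta n' ^ (w * q%:Z ^+ j))).
  by apply: max_poly_roots => //; rewrite -lead_coef_eq0 monPc oner_eq0.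
rewrite (@all_roots_prod_XsubC _ (P \Po 'X^D) rootsL) //.
- by rewrite monPc scale1r.
- by rewrite szP size_map size_iota tauE.
- by rewrite uniq_rootsE.
Qed.

Lemma cosetpoly_expansion : cosetpoly zeta n q (- eta_yx p eta yx) =
  \sum_(i < om.+1) ((-1) ^+ (om - i) *
    \sum_(U : {set 'I_om} | #|U| == (om - i)%N)
      \prod_(u in U) zeta N ^ (- (eta_x eta yx * q%:Z ^+ u))) *: 'X^(D * i).
Proof.
rewrite cosetpoly_comp -(big_map (fun u => zeta N ^ (w * q%:Z ^+ u)) xpredT
  (fun z => 'X - z%:P)) -/rootsR.
have szR : size rootsR = om by rewrite size_map size_iota.
rewrite comp_polyE size_prod_XsubC szR; apply: eq_bigr => i _.
rewrite -exprM; congr (_ *: _); rewrite coef_prod_XsubC szR -1?ltnS //.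
congr (_ * _); apply: eq_bigr => U _; apply: eq_bigr => u _.
by rewrite (nth_map 0%N) ?size_iota // nth_iota // mulNr.
Qed.

End CosetPolynomialExpansion.

(** * Cyclic codes and their duals *)

Lemma rVpolyE (R : nzRingType) (m : nat) (x : 'rV[R]_m) :
  rVpoly x = \sum_(i < m) x 0 i *: 'X^i.
Proof. by rewrite /rVpoly poly_def; apply: eq_bigr => i _; rewrite valK. Qed.

Section Cyclic.

Variables (F : fieldType) (m : nat).
Hypothesis m_gt0 : (0 < m)%N.

Let P : {poly F} := 'X^m - 1.

Lemma size_Xm_sub_1 : size P = m.+1.
Proof. by rewrite size_XnsubC. Qed.

Lemma Xm_sub_1_neq0 : P != 0.
Proof. by rewrite -size_poly_eq0 size_Xm_sub_1. Qed.

Lemma dvdp_Xk_sub_1 k : (m %| k)%N -> P %| 'X^k - 1.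
Proof. by case/dvdnP=> c ->; rewrite mulnC exprM subrX1 dvdp_mulr. Qed.

Lemma modp_Xk k : 'X^k %% P = 'X^(k %% m).
Proof.
rewrite -[RHS](@modp_small _ _ P); last by rewrite size_polyXn size_Xm_sub_1 ltnS ltn_mod.
apply/eqP; rewrite -subr_eq0 -modpN -modpD [in 'X^k](divn_eq k m) exprD.
by rewrite -[X in _ - X]mul1r -mulrBl; apply/dvdp_mulr/dvdp_Xk_sub_1/dvdn_mull.
Qed.

Lemma coprimep_Xk k : coprimep P 'X^k.
Proof.
apply: coprimep_expr; rewrite coprimepX.
by rewrite rootE hornerD hornerN hornerC hornerXn expr0n gtn_eqF // sub0r oppr_eq0 oner_eq0.
Qed.

(** A linear form on F[X]/(X^m - 1): the inner product of two words is its value at x(X) y(X^-1). *)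
Definition cyclic_coef0 (A : {poly F}) : F := (A %% P)`_0.

Lemma cyclic_coef0_sum (I : finType) (f : I -> F) (k : I -> nat) :
  cyclic_coef0 (\sum_i f i *: 'X^(k i)) = \sum_(i | (m %| k i)%N) f i.
Proof.
rewrite [RHS]big_mkcond; apply: (big_rec2 (fun A c => cyclic_coef0 A = c)).
  by rewrite /cyclic_coef0 mod0p coef0.
move=> i c A _ <-; rewrite /cyclic_coef0 modpD modpZl modp_Xk coefD coefZ coefXn eq_sym.
by rewrite -/(dvdn m (k i)); case: (m %| k i)%N; rewrite ?mulr1 ?mulr0.
Qed.

(** The involution X -> X^-1 of the quotient, written with polynomials only. *)
Let sigma (A : {poly F}) := A \Po 'X^(m.-1).

(** The exponent on the left stands for i - j modulo m. *)
Lemma dvdn_add_mul_pred (i j : 'I_m) : (m %| i + m.-1 * j)%N = (i == j).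
Proof.
have mE : (i + m.-1 * j + j = j * m + i)%N.
  by case: (m) m_gt0 i j => // m' _ i j; rewrite -addnA -mulSnr addnC mulnC.
rewrite /dvdn -[0%N in X in _ == X](mod0n m) -(eqn_modDr j) mE modnMDl add0n !modn_small //.
Qed.

Lemma rVpoly_dot (x y : 'rV[F]_m) :
  \sum_(i < m) x 0 i * y 0 i = cyclic_coef0 (rVpoly x * sigma (rVpoly y)).
Proof.
have -> : rVpoly x * sigma (rVpoly y) =
    \sum_(ij : 'I_m * 'I_m) (x 0 ij.1 * y 0 ij.2) *: 'X^(ij.1 + m.-1 * ij.2).
  rewrite /sigma !rVpolyE raddf_sum /= mulr_suml -[RHS](pair_bigA_idem _
    (fun i j => (x 0 i * y 0 j) *: 'X^(i + m.-1 * j))) /= ?addr0 //.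
  apply: eq_bigr => i _; rewrite mulr_sumr; apply: eq_bigr => j _.
  by rewrite comp_polyZ comp_Xn_poly -exprM exprD -!scalerAr -!scalerAl scalerA mulrC.
rewrite cyclic_coef0_sum (eq_bigl (fun ij => ij.1 == ij.2)) => [|ij]; last first.
  by rewrite dvdn_add_mul_pred.
rewrite -(pair_big_dep xpredT (fun i j => i == j) (fun i j => x 0 i * y 0 j)) /=.
by apply: eq_bigr => i _; rewrite (big_pred1 i) // => j; rewrite /= eq_sym.
Qed.

(** Multiplying by X^((m-1)k), that is by X^-k, brings the k-th coefficient to degree 0. *)
Lemma cyclic_coef0_nondegenerate (A : {poly F}) :
  (forall k, cyclic_coef0 (A * 'X^(m.-1 * k)) = 0) -> P %| A.
Proof.
move=> A0; apply/eqP/polyP => k; rewrite coef0.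
case: (ltnP k m) => [km|mk]; last first.
  by rewrite nth_default // (leq_trans _ mk) // -ltnS -size_Xm_sub_1 ltn_modp Xm_sub_1_neq0.
pose k0 := Ordinal km; transitivity (cyclic_coef0 (A * 'X^(m.-1 * k))); last exact: A0.
rewrite /cyclic_coef0 mulrC -modp_mul mulrC; set B := A %% P.
have -> : B = \sum_(i < m) B`_i *: 'X^i.
  rewrite -poly_def; apply/polyP => i; rewrite coef_poly.
  case: ltnP => // mi; rewrite nth_default // (leq_trans _ mi) //.
  by rewrite -ltnS -size_Xm_sub_1 ltn_modp Xm_sub_1_neq0.
rewrite mulr_suml; set S := (\sum_(i < m) _ * _).
have -> : S = \sum_(i < m) B`_i *: 'X^(i + m.-1 * k0).
  by apply: eq_bigr => i _; rewrite -scalerAl -exprD.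
rewrite -/(cyclic_coef0 _) cyclic_coef0_sum [RHS](eq_bigl (pred1 k0)) => [|i].
  rewrite big_pred1_eq coef_sum (bigD1 k0) //= coefZ coefXn eqxx mulr1 big1 ?addr0 // => i ik.
  by rewrite coefZ coefXn -[k]/(val k0) val_eqE eq_sym (negbTE ik) mulr0.
by rewrite dvdn_add_mul_pred.
Qed.

(** In the quotient, [sigma A] and B agree up to a unit of the form c X^k. The relation is
    multiplicative, so it is checked on linear factors, and such units do not affect divisibility by
    X^m - 1. *)
Definition reciprocal (A B : {poly F}) : Prop :=
  exists2 c : F, c != 0 & exists k, P %| 'X^k * sigma A - c *: B.

Lemma reciprocal1 : reciprocal 1 1.
Proof.
exists 1; rewrite ?oner_eq0 //; exists 0%N.
by rewrite expr0 mul1r scale1r /sigma comp_polyC subrr dvdp0.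
Qed.

Lemma reciprocalM A B A' B' :
  reciprocal A B -> reciprocal A' B' -> reciprocal (A * A') (B * B').
Proof.
move=> [c c0 [k AB]] [c' c'0 [k' AB']]; exists (c * c'); first by rewrite mulf_neq0.
exists (k + k')%N; rewrite /sigma comp_polyM exprD mulrACA -scalerA scalerAr scalerAl.
rewrite -/(sigma A) -/(sigma A').
have -> a b a' b' : a * b - a' * b' = (a - a') * b + a' * (b - b') :> {poly F}.
  by rewrite mulrBl mulrBr addrA subrK.
by apply: dvdp_add; [apply: dvdp_mulr|apply: dvdp_mull].
Qed.

Lemma reciprocalX A B k : reciprocal A B -> reciprocal (A ^+ k) (B ^+ k).
Proof.
move=> AB; elim: k => [|k IH]; first exact: reciprocal1.
by rewrite !exprS; apply: reciprocalM.
Qed.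

Lemma reciprocal_prod (I : Type) (r : seq I) (Q : pred I) (A B : I -> {poly F}) :
  (forall i, Q i -> reciprocal (A i) (B i)) ->
  reciprocal (\prod_(i <- r | Q i) A i) (\prod_(i <- r | Q i) B i).
Proof.
move=> AB; apply: (big_ind2 reciprocal) => //; first exact: reciprocal1.
by move=> *; apply: reciprocalM.
Qed.

Lemma reciprocal_XsubC (z : F) : z != 0 -> reciprocal ('X - z%:P) ('X - z^-1%:P).
Proof.
move=> z0; exists (- z); first by rewrite oppr_eq0.
exists 1%N; rewrite /sigma comp_polyB comp_polyX comp_polyC mulrBr -exprD add1n prednK //.
rewrite scalerBr -mul_polyC -[- z *: _]mul_polyC -polyCM mulNr divff //.
by rewrite !polyCN mulNr opprK expr1 [_%:P * 'X]mulrC opprD opprK addrA subrK.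
Qed.

Lemma dvdp_reciprocal A B (C : {poly F}) : reciprocal A B ->
  (P %| C * sigma A) = (P %| C * B).
Proof.
move=> [c c0 [k AB]]; rewrite -(Gauss_dvdpr _ (coprimep_Xk k)) mulrCA.
rewrite -[RHS](dvdpZr _ _ c0) scalerAr -[in LHS](subrK (c *: B) ('X^k * _)) mulrDr.
by rewrite dvdp_addr // dvdp_mull.
Qed.

End Cyclic.

(** * Generators and duals of cyclic codes *)

Section CyclicCodes.

Variables (F : finFieldType) (m : nat).
Hypothesis m_gt0 : (0 < m)%N.

Let P : {poly F} := 'X^m - 1.

Lemma poly_rV_modpK (A : {poly F}) : rVpoly (poly_rV (A %% P) : 'rV[F]_m) = A %% P.
Proof. by rewrite poly_rV_K // -ltnS -(size_Xm_sub_1 F m_gt0) ltn_modp Xm_sub_1_neq0. Qed.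

Lemma rVpoly_modp (x : 'rV[F]_m) : rVpoly x %% P = rVpoly x.
Proof. by rewrite modp_small // size_Xm_sub_1 // ltnS size_poly. Qed.

Lemma mem_ideal_code (g : {poly F}) (x : 'rV[F]_m) :
  g %| P -> (x \in ideal_code m g) = (g %| rVpoly x).
Proof.
move=> gP; apply/ideal_codeP/idP => // [[h hx]|/dvdpP[h hx]].
  by rewrite -(dvdp_subl _ (dvdp_mulIl g h)) (dvdp_trans gP).
by exists h; rewrite hx mulrC subrr dvdp0.
Qed.

Lemma ideal_code_inj (g h : {poly F}) : g %| P -> h %| P ->
  ideal_code m g = ideal_code m h <-> g %= h.
Proof.
move=> gP hP; split=> [gh|gh]; last first.
  by apply/setP => x; rewrite !mem_ideal_code // (eqp_dvdl _ gh).
suff W a b : a %| P -> b %| P -> ideal_code m a = ideal_code m b -> b %| a.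
  by rewrite /eqp (W h g) ?(W g h).
move=> aP bP ab; have : poly_rV (a %% P) \in ideal_code m a.
  by rewrite mem_ideal_code // poly_rV_modpK -(dvdp_mod _ aP).
by rewrite ab mem_ideal_code // poly_rV_modpK -(dvdp_mod _ bP).
Qed.

(** The polynomials whose residue lies in C form an ideal containing X^m - 1. The generator is the
    gcd of X^m - 1 and the finitely many words of C; Bezout keeps it in the ideal. *)
Lemma cyclic_code_generator (C : {set 'rV[F]_m}) : cyclic_code C ->
  exists2 g : {poly F}, g %| P & C = ideal_code m g.
Proof.
move=> [[C0 Clin] Cshift].
pose I (A : {poly F}) := poly_rV (A %% P) \in C.
have I0 A : P %| A -> I A by move/eqP; rewrite /I => ->; rewrite raddf0.
have Ilin c A B : I A -> I B -> I (c *: A + B).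
  by rewrite /I modpD modpZl linearP => IA IB; apply: Clin.
(* The cyclic shift multiplies by X modulo X^m - 1; reindexing by the cyclic successor aligns the
   two sums. *)
have IX A : I A -> I (A * 'X).
  move=> /Cshift; rewrite /I; set x := poly_rV _; congr (_ \in C).
  apply: (can_inj rVpolyK); rewrite poly_rV_modpK -rVpoly_modp mulrC -modp_mul.
  rewrite -(poly_rV_modpK A) -/x; apply/eqP; rewrite -subr_eq0 -modpN -modpD.
  rewrite !rVpolyE (reindex_inj (@ordS_inj _)) mulr_sumr -sumrB -/(dvdp P _).
  apply: (big_ind (dvdp P)) => [|a b|i _]; [exact: dvdp0|exact: dvdp_add|].
  rewrite mxE ordSK -scalerAr -scalerBr -exprS -mul_polyC; apply/dvdp_mull.
  by rewrite /dvdp modpD modpN !modp_Xk // modn_mod subrr.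
have IM A B : I A -> I (A * B).
  move=> IA; elim/poly_ind: B => [|B c IB]; first by rewrite mulr0; apply: I0; apply: dvdp0.
  by rewrite mulrDr mulrA addrC [A * _]mulrC mul_polyC; apply: Ilin => //; apply: IX.
have Igcd A B : I A -> I B -> I (gcdp A B).
  move=> IA IB; have [[u w] /= uw] := Bezoutp A B.
  have /eqpP[[c d] /= /andP[c0 d0] cd] := uw.
  have -> : gcdp A B = d^-1 *: (c *: (A * u + B * w)) + 0.
    by rewrite addr0 [A * u]mulrC [B * w]mulrC cd scalerA mulVf // scale1r.
  have II : I 0 by apply: I0; apply: dvdp0.
  apply: (Ilin) => //; rewrite scalerDr; apply: (Ilin); first exact: IM.
  by rewrite -[_ *: _]addr0; apply: (Ilin) => //; apply: IM.
have IC x : x \in C -> I (rVpoly x) by rewrite /I rVpoly_modp rVpolyK.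
pose gen r := foldr (fun x : 'rV[F]_m => gcdp (rVpoly x)) P r.
have gen_P r : gen r %| P.
  by elim: r => //= x r; apply: dvdp_trans; apply: dvdp_gcdr.
have gen_mem r x : x \in r -> gen r %| rVpoly x.
  elim: r => //= y r IH; rewrite inE => /orP[/eqP ->|/IH]; first exact: dvdp_gcdl.
  by apply: dvdp_trans; apply: dvdp_gcdr.
have I_gen r : {subset r <= C} -> I (gen r).
  elim: r => [|x r IH] rC /=; first by apply: I0; apply: dvdpp.
  apply: Igcd; first by apply/IC/rC/mem_head.
  by apply: IH => y yr; apply: rC; rewrite inE yr orbT.
exists (gen (enum C)) => //; apply/setP => x; rewrite mem_ideal_code //.
apply/idP/idP => [xC|/dvdpP[h xE]]; first by apply: gen_mem; rewrite mem_enum.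
rewrite -[x]rVpolyK -rVpoly_modp xE mulrC; apply/IM/I_gen => y.
by rewrite mem_enum.
Qed.

(** Orthogonality to every g X^k says that the constant coefficients of x(X) g(X^-1) X^-k all
    vanish; by nondegeneracy the product x(X) g(X^-1) is then 0 in the quotient. *)
Lemma mem_dual_ideal_code (g : {poly F}) (x : 'rV[F]_m) :
  (x \in dual_code (ideal_code m g)) = (P %| rVpoly x * (g \Po 'X^(m.-1))).
Proof.
have sigma_mod A B : P %| A - B -> P %| (A \Po 'X^(m.-1)) - (B \Po 'X^(m.-1)).
  rewrite -comp_polyB => /(dvdp_comp_poly 'X^(m.-1)); apply: dvdp_trans.
  by rewrite comp_polyB comp_Xn_poly comp_polyC -exprM dvdp_Xk_sub_1 // dvdn_mull.
have dotE (y : 'rV[F]_m) A : P %| rVpoly y - A ->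
    \sum_(i < m) x 0 i * y 0 i = cyclic_coef0 m (rVpoly x * (A \Po 'X^(m.-1))).
  move=> /sigma_mod yA; rewrite (rVpoly_dot m_gt0) /cyclic_coef0.
  suff -> : (rVpoly x * (rVpoly y \Po 'X^(m.-1))) %% P =
      (rVpoly x * (A \Po 'X^(m.-1))) %% P by [].
  by apply/eqP; rewrite -subr_eq0 -modpN -modpD -mulrBr; apply: dvdp_mull.
rewrite inE; apply/forallP/idP => [H|H y].
  apply: (cyclic_coef0_nondegenerate m_gt0) => k.
  pose y : 'rV[F]_m := poly_rV ((g * 'X^k) %% P).
  have yE : P %| rVpoly y - g * 'X^k.
    by rewrite /dvdp modpD modpN rVpoly_modp poly_rV_modpK subrr.
  have /implyP/(_ _)/eqP := H y; rewrite (dotE _ _ yE) comp_polyM comp_Xn_poly -exprM.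
  by rewrite mulrA; apply; apply/ideal_codeP => //; exists 'X^k.
apply/implyP => /(ideal_codeP _ _ m_gt0)[h yh]; rewrite (dotE _ _ yh) comp_polyM mulrA.
by rewrite /cyclic_coef0 -modp_mul mulrC -modp_mul (eqP H) mulr0 mod0p coef0.
Qed.

End CyclicCodes.

(** * Factorization along the cyclotomic cosets *)

Lemma eqp_mup (L : fieldType) (x : L) (f g : {poly L}) :
  f != 0 -> f %= g -> mup x f = mup x g.
Proof.
move=> f0 fg; have g0 : g != 0 by rewrite -size_poly_eq0 -(eqp_size fg) size_poly_eq0.
have H k : (k <= mup x f)%N = (k <= mup x g)%N by rewrite !mup_geq // (eqp_dvdr _ fg).
by apply/eqP; rewrite eqn_leq -H leqnn H leqnn.
Qed.

Lemma mup_prod_XsubCX (L : fieldType) (I : finType) (z : I -> L) (f : I -> nat) (j : I) :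
  injective z -> mup (z j) (\prod_i ('X - (z i)%:P) ^+ f i) = f j.
Proof.
move=> z_inj; rewrite (bigD1 j) //= mupMl ?mup_XsubCX ?eqxx //.
rewrite rootE horner_prod; apply/prodf_neq0 => i ij.
by rewrite horner_exp expf_neq0 // hornerXsubC subr_eq0 (inj_eq z_inj) eq_sym.
Qed.

Lemma dvdp_prod_XsubCX (L : fieldType) (I : finType) (z : I -> L) (K : nat) (g : {poly L}) :
  injective z -> g %| (\prod_i ('X - (z i)%:P)) ^+ K ->
  g %= \prod_i ('X - (z i)%:P) ^+ mup (z i) g.
Proof.
(* The power is written as a product over K copies of the index list, since the divisors of such a
   product are products over sublists. *)
move=> z_inj gP; pose t0 : seq I := flatten (nseq K (index_enum I)).
have t0E : (\prod_i ('X - (z i)%:P)) ^+ K = \prod_(i <- t0) ('X - (z i)%:P).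
  rewrite /t0; elim: (K) => [|k IH] /=; first by rewrite big_nil.
  by rewrite exprS big_cat IH.
rewrite t0E in gP; have [msk] := dvdp_prod_XsubC gP.
set t := mask _ _ => gt.
have tE : \prod_(i <- t) ('X - (z i)%:P) = \prod_i ('X - (z i)%:P) ^+ count_mem i t.
  elim: (t) => [|i r IH]; first by rewrite big_nil big1.
  rewrite big_cons IH (bigD1 i) //= [in RHS](bigD1 i) //= eqxx add1n exprS mulrA.
  by congr (_ * _); apply: eq_bigr => j ji; rewrite eq_sym (negbTE ji).
have g0 : g != 0.
  rewrite -size_poly_eq0 (eqp_size gt) size_poly_eq0 tE.
  by apply/prodf_neq0 => i _; rewrite expf_neq0 ?polyXsubC_eq0.
apply: (eqp_trans gt); rewrite tE; apply/eqpP; exists (1, 1); rewrite ?oner_eq0 //=.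
congr (_ *: _); apply: eq_bigr => i _; congr (_ ^+ _).
by rewrite (eqp_mup _ g0 gt) tE mup_prod_XsubCX.
Qed.

(** * Invariance of root multiplicities under Frobenius *)

Section Frobenius.

Variables (F : finFieldType) (L : fieldType) (iota : {rmorphism F -> L}).

Lemma exists_Frobenius :
  exists fr : {rmorphism L -> L}, forall x, fr x = x ^+ #|F|.
Proof.
pose f (x : L) := x ^+ #|F|.
have [r _ rF] := finPcharP F.
have pnat : [pchar L].-nat #|F|.
  rewrite (card_pprimeChar rF) (eq_pnat _ (pcharf_eq (rmorph_pchar iota rF))).
  by rewrite pnatX pnat_id // (pcharf_prime rF).
have fA : zmod_morphism f by move=> x y; rewrite /f exprDn_pchar // exprNn_pchar.
have fM : monoid_morphism f.
  by rewrite /f; split=> [|x y]; rewrite ?exprMn ?expr1n.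
pose fr : {rmorphism L -> L} := HB.pack f
  (GRing.isZmodMorphism.Build _ _ f fA) (GRing.isMonoidMorphism.Build _ _ f fM).
by exists fr.
Qed.

(** Frobenius fixes a polynomial with coefficients in F and sends the powers of X - z to those of X
    - z^q. *)
Lemma mup_Frobenius (g : {poly F}) (z : L) : g != 0 ->
  mup (z ^+ #|F|) (map_poly iota g) = mup z (map_poly iota g).
Proof.
move=> g0; have [fr frE] := exists_Frobenius.
have frg : map_poly fr (map_poly iota g) = map_poly iota g.
  by apply/polyP => i; rewrite !coef_map /= frE -rmorphXn /= expf_card.
have g'0 : map_poly iota g != 0 by rewrite map_poly_eq0.
have H k : (k <= mup (z ^+ #|F|) (map_poly iota g))%N = (k <= mup z (map_poly iota g))%N.
  rewrite !mup_geq // -{1}frg -frE.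
  have -> : ('X - (fr z)%:P) ^+ k = map_poly fr (('X - z%:P) ^+ k).
    by rewrite rmorphXn rmorphB /= map_polyX map_polyC.
  by rewrite dvdp_map.
by apply/eqP; rewrite eqn_leq -H leqnn H leqnn.
Qed.

End Frobenius.

(** * Cyclotomic cosets modulo n and their polynomials *)

Section Cosets.

Variables (n q : nat).
Hypotheses (n_gt0 : (0 < n)%N) (co_qn : coprime q n).

(** Bounding the exponent makes membership decidable; [coset_memP] removes the bound by
    periodicity. *)
Definition coset_mem (gamma z : int) : bool :=
  [exists k : 'I_(coset_size n q gamma), (z == gamma * q%:Z ^+ k %[mod n])%Z].

Lemma coset_memP (gamma z : int) :
  reflect (exists k : nat, (z = gamma * q%:Z ^+ k %[mod n])%Z) (coset_mem gamma z).
Proof.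
apply: (iffP existsP) => [[k /eqP zk]|[k zk]]; first by exists k.
have [per _] := coset_sizeP gamma n_gt0 co_qn; set tau := coset_size _ _ _ in per *.
have lt_k : (k %% tau < tau)%N by rewrite ltn_mod.
exists (Ordinal lt_k); rewrite zk /= {1}(divn_eq k tau); apply/eqP.
elim: (k %/ tau)%N => // c IH; rewrite mulSn -addnA exprD mulrA.
by rewrite -modzMml per modzMml.
Qed.

Lemma coset_mem_sym (a b : int) : coset_mem a b = coset_mem b a.
Proof.
by apply/coset_memP/coset_memP => -[k] /(coset_sym n_gt0 co_qn).
Qed.

Lemma coset_mem_trans (b a c : int) : coset_mem a b -> coset_mem b c -> coset_mem a c.
Proof.
move=> /coset_memP[j bj] /coset_memP[k ck]; apply/coset_memP; exists (j + k)%N.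
by rewrite ck -modzMml bj modzMml exprD mulrA.
Qed.

Lemma coset_mem_opp (a b : int) : coset_mem (- a) (- b) = coset_mem a b.
Proof.
suff W c d : coset_mem c d -> coset_mem (- c) (- d).
  by apply/idP/idP => /W //; rewrite !opprK.
by move=> /coset_memP[k dk]; apply/coset_memP; exists k; rewrite mulNr; apply: eqz_modN.
Qed.

Lemma coset_mem_mod (a b b' : int) : (b = b' %[mod n])%Z -> coset_mem a b = coset_mem a b'.
Proof. by move=> bb; apply: eq_existsb => k; rewrite bb. Qed.

Lemma coset_sizeN (gamma : int) : coset_size n q (- gamma) = coset_size n q gamma.
Proof.
rewrite /coset_size /first_pos; congr _.+1; apply: eq_find => k.
by rewrite mulNr !eqz_mod_dvd -opprD dvdzE abszN -dvdzE //.
Qed.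

Lemma ordz_subproof (z : int) : (`|(z %% n)%Z| < n)%N.
Proof.
have n0 : n%:Z != 0 by rewrite eqz_nat -lt0n.
by rewrite -ltz_nat gez0_abs ?modz_ge0 // ltz_pmod.
Qed.

Definition ordz (z : int) : 'I_n := Ordinal (ordz_subproof z).

Lemma ordzE (z : int) : (ordz z : int) = (z %% n)%Z.
Proof. by rewrite /= gez0_abs ?modz_ge0 // eqz_nat -lt0n. Qed.

Lemma ordz_mod (z : int) : (ordz z = z %[mod n])%Z.
Proof. by rewrite ordzE modz_mod. Qed.

Variables (L : fieldType) (zeta : nat -> L).
Hypothesis zeta_prim : n.-primitive_root (zeta n).

Lemma exprz_ordz (z : int) : zeta n ^ z = zeta n ^+ ordz z.
Proof. by apply/eqP; rewrite exprnP (prim_exprz_eq _ _ zeta_prim) ordz_mod. Qed.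

Lemma prim_ord_inj : injective (fun i : 'I_n => zeta n ^+ i).
Proof.
move=> i j /eqP; rewrite (eq_prim_root_expr zeta_prim) !modn_small //.
by move/eqP/val_inj.
Qed.

Lemma cosetpoly_prod (gamma : int) : cosetpoly zeta n q gamma =
  \prod_(i < n | coset_mem gamma i) ('X - (zeta n ^+ i)%:P).
Proof.
pose h (k : 'I_(coset_size n q gamma)) := ordz (gamma * q%:Z ^+ k).
rewrite (eq_bigl (mem (h @: setT))) => [|i]; last first.
  apply/existsP/imsetP => [[k /eqP ik]|[k _ ->]]; exists k; rewrite ?ordz_mod //.
  apply/val_inj/eqP; rewrite -eqz_nat ordzE -ik modz_small //.
  by rewrite ltz_nat ltn_ord.
rewrite big_imset /=; last first.
  move=> i j _ _; wlog le_ij : i j / (i <= j)%N.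
    by move=> W; case: (leqP i j) => [|/ltnW] ij H; [apply: W|symmetry; apply: W].
  move=> /(congr1 (fun i : 'I_n => (i : int))); rewrite !ordzE => ij.
  apply/val_inj/eqP; case: ltngtP le_ij => // lt_ij _.
  have [_ least] := coset_sizeP gamma n_gt0 co_qn.
  suff : (coset_size n q gamma <= j - i)%N by rewrite leqNgt (leq_ltn_trans (leq_subr _ _)).
  apply: least; first by rewrite subn_gt0.
  symmetry; apply: (@eqmodz_cancel _ _ _ (q%:Z ^+ i)).
    by apply: coprimezXl; rewrite coprimezE.
  by rewrite [X in (X %% _)%Z = _]mulrC ij mulrCA -exprD subnKC 1?ltnW // mulrC.
by rewrite /cosetpoly; apply: eq_big => [k|k _]; [rewrite inE|rewrite -exprz_ordz].
Qed.

Lemma cosetpoly_eq (a b : int) : coset_mem a b ->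
  cosetpoly zeta n q a = cosetpoly zeta n q b.
Proof.
move=> ab; rewrite !cosetpoly_prod; apply: eq_bigl => i.
apply/idP/idP; last exact: coset_mem_trans.
by apply: coset_mem_trans; rewrite coset_mem_sym.
Qed.

Lemma zeta_neq0 : zeta n != 0.
Proof.
apply/eqP => z0; have := prim_expr_order zeta_prim.
by rewrite z0 expr0n gtn_eqF // => /eqP; rewrite eq_sym oner_eq0.
Qed.

Lemma reciprocal_cosetpoly (m : nat) (gamma : int) : (0 < m)%N ->
  reciprocal m (cosetpoly zeta n q gamma) (cosetpoly zeta n q (- gamma)).
Proof.
move=> m_gt0; rewrite /cosetpoly coset_sizeN; apply: reciprocal_prod => k _.
have := reciprocal_XsubC m_gt0 (expfz_neq0 (gamma * q%:Z ^+ k) zeta_neq0).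
by rewrite mulNr invr_expz.
Qed.

End Cosets.

(** * Self-dual codes *)

Section SelfDualCodes.

Variables (F : finFieldType) (L : fieldType) (iota : {rmorphism F -> L}).
Variables (zeta : nat -> L) (a q v s n m : nat) (p e : 'I_s -> nat) (eta : 'I_s -> int).
Variables (t : nat) (sg : nat -> nat).
Hypotheses (ha : (1 <= a)%N) (hq : q = (2 ^ a)%N) (hF : #|F| = q).
Hypothesis hzeta : compatible_roots zeta q.
Hypothesis hv : (1 <= v)%N.
Hypotheses (p_prime : forall i, prime (p i)) (p_odd : forall i, odd (p i)).
Hypotheses (p_inj : injective p) (e_gt0 : forall i, (0 < e i)%N).
Hypotheses (hn : n = (\prod_(i < s) p i ^ e i)%N) (hm : m = (2 ^ v * n)%N).
Hypothesis hsg : grouping p q t sg.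
Hypothesis heta : primitive_root_system p e eta.

Let M := cosetpolyF iota zeta n q.
Let Sig := Sigma p e q n.
(** By [mem_U], these are the indices in [Sig] fixed by [opposite_rep]. *)
Let U := Sigma_0 p e q n :|: Sigma' p e q n t sg.
Let et : yxindex s n -> int := eta_yx p eta.

Let co_qn : coprime q n.
Proof. by rewrite hq coprimeXl // coprime2n (n_odd p_odd hn). Qed.

Let n_gt0 : (0 < n)%N.
Proof. by case: (n) (n_odd p_odd hn). Qed.

Let m_gt0 : (0 < m)%N.
Proof. by rewrite hm muln_gt0 expn_gt0 n_gt0. Qed.

Let zeta_prim : n.-primitive_root (zeta n).
Proof. by case: hzeta => + _; apply; rewrite coprime_sym. Qed.

Let P : {poly F} := 'X^m - 1.

Let map_M gamma : map_poly iota (M gamma) = cosetpoly zeta n q gamma.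
Proof. exact: map_cosetpolyF. Qed.

(** The default is never taken, because every integer lies in the coset of some index ([repP]). *)
Definition coset_rep (z : int) : yxindex s n :=
  odflt ([ffun=> ord0], [ffun=> ord0])
    [pick yx in Sigma p e q n | coset_mem n q (eta_yx p eta yx) z].

Let repP z : coset_rep z \in Sig /\ coset_mem n q (et (coset_rep z)) z.
Proof.
rewrite /coset_rep; case: pickP => [yx /andP[]//|no].
have [yx Syx [j zE]] := Sigma_repr p_prime p_inj e_gt0 hn co_qn heta z.
by have := no yx; rewrite Syx /= => /negbT/negP[]; apply/(coset_memP n_gt0 co_qn); exists j.
Qed.

Let rep_uniq z yx : yx \in Sig -> coset_mem n q (et yx) z -> coset_rep z = yx.
Proof.
move=> Syx zyx; have [Sr zr] := repP z.
have : coset_mem n q (et yx) (et (coset_rep z)).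
  by apply: coset_mem_trans zyx _; rewrite // coset_mem_sym.
move=> /(coset_memP n_gt0 co_qn)[j].
exact: (Sigma_inj p_prime p_inj e_gt0 hn co_qn heta).
Qed.

Let rep_eq z yx : yx \in Sig -> (coset_rep z == yx) = coset_mem n q (et yx) z.
Proof.
by move=> Syx; apply/eqP/idP => [<-|/rep_uniq ->//]; case: (repP z).
Qed.

Let rep_et yx : yx \in Sig -> coset_rep (et yx) = yx.
Proof.
move=> S; apply: rep_uniq => //; apply/(coset_memP n_gt0 co_qn).
by exists 0%N; rewrite expr0 mulr1.
Qed.

Let rep_mod z z' : (z = z' %[mod n])%Z -> coset_rep z = coset_rep z'.
Proof.
move=> zz; have [S zr] := repP z'; apply: rep_uniq => //.
by rewrite (coset_mem_mod _ _ zz).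
Qed.

Definition opposite_rep (yx : yxindex s n) := coset_rep (- eta_yx p eta yx).

Let opp_Sig yx : opposite_rep yx \in Sig. Proof. by case: (repP (- et yx)). Qed.

Let opp_mem yx : coset_mem n q (et (opposite_rep yx)) (- et yx).
Proof. by case: (repP (- et yx)). Qed.

Let oppK yx : yx \in Sig -> opposite_rep (opposite_rep yx) = yx.
Proof.
move=> S; apply: rep_uniq => //; rewrite (coset_mem_sym n_gt0 co_qn).
rewrite -(coset_mem_opp n_gt0 co_qn) opprK.
exact: opp_mem.
Qed.

Let opp_inj : {in Sig &, injective opposite_rep}.
Proof. by move=> x y Sx Sy /(congr1 opposite_rep); rewrite !oppK. Qed.

Let opp_classP yx yx' : yx' \in Sig -> opp_class p q eta yx yx' <-> opposite_rep yx = yx'.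
Proof.
move=> S'; split=> [[j H]|<-]; last first.
  by have /(coset_memP n_gt0 co_qn) := opp_mem yx.
by apply: rep_uniq => //; apply/(coset_memP n_gt0 co_qn); exists j.
Qed.

Let simP yx yx' : yx \in Sig -> yx' \in Sig ->
  sim p q eta yx yx' <-> yx = yx' \/ opposite_rep yx = yx'.
Proof.
move=> S S'; split=> [[j [H|H]]|[->|/opp_classP]].
- left; rewrite -(rep_et S); apply: rep_uniq => //.
  by apply/(coset_memP n_gt0 co_qn); exists j.
- by right; apply/opp_classP => //; exists j.
- by exists 0%N; left; rewrite expr0 mulr1.
- by case/(_ S') => j H; exists j; right.
Qed.

Let U_sub : {subset U <= Sig}.
Proof.
move=> yx; rewrite /U in_setU => /orP[]; first by rewrite inE => /andP[].
rewrite /Sigma'; elim/big_ind: _ => [|A B HA HB|k _]; first by rewrite inE.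
  by rewrite inE => /orP[/HA|/HB].
by rewrite inE => /andP[].
Qed.

Let mem_U yx : yx \in Sig -> (yx \in U) = (opposite_rep yx == yx).
Proof.
move=> S; apply/idP/eqP => [|oy].
  move=> yU; apply/opp_classP => //; move: yU; rewrite in_setU => /orP[].
    exact: (Sigma_0_opp p_prime p_inj e_gt0 hn heta).
  exact: (Sigma'_opp p_prime p_odd p_inj e_gt0 hn co_qn heta hsg).
apply: (opp_class_self p_prime p_odd p_inj e_gt0 hn co_qn heta hsg) => //.
exact/opp_classP.
Qed.

Let G (Om : yxindex s n -> nat) : {poly F} := \prod_(yx in Sig) M (et yx) ^+ Om yx.

(** Every residue lies in the coset of exactly one index, so a product over cosets is a product over
    all n-th roots of unity. *)
Let map_G Om :
  map_poly iota (G Om) = \prod_(i < n) ('X - (zeta n ^+ i)%:P) ^+ Om (coset_rep i).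
Proof.
rewrite rmorph_prod (partition_big (fun i : 'I_n => coset_rep i) (mem Sig)) /=; last first.
  by move=> i _; case: (repP i).
apply: eq_bigr => yx S; rewrite rmorphXn /= map_M (cosetpoly_prod n_gt0 co_qn zeta_prim).
rewrite -prodrXl; apply: eq_big => [i|i]; first by rewrite rep_eq.
by rewrite -rep_eq // => /eqP ->.
Qed.

Let map_P : map_poly iota P = 'X^m - 1.
Proof. by rewrite rmorphB /= map_polyXn rmorph1. Qed.

Let pchar_L : 2 \in [pchar L].
Proof.
have [r r_prime rF] := finPcharP F; have := rmorph_pchar iota rF.
have cardF : #|F| = (r ^ logn r #|F|)%N := card_pprimeChar rF.
have : (2 %| r ^ logn r #|F|)%N by rewrite -cardF hF hq dvdn_exp.
by rewrite Euclid_dvdX // dvdn_prime2 // => /andP[/eqP <- _].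
Qed.

Let Xm_sub_1 : 'X^m - 1 = (\prod_(i < n) ('X - (zeta n ^+ i)%:P)) ^+ (2 ^ v).
Proof.
rewrite -(big_mkord xpredT (fun i => 'X - (zeta n ^+ i)%:P)) (factor_Xn_sub_1 zeta_prim).
have pn : [pchar {poly L}].-nat (2 ^ v)%N.
  by rewrite (eq_pnat _ (pchar_poly L)) (eq_pnat _ (pcharf_eq pchar_L)) pnatX pnat_id.
by rewrite exprDn_pchar // exprNn_pchar // expr1n -exprM hm mulnC.
Qed.

Let G_const : G (fun=> (2 ^ v)%N) = P.
Proof. by apply: (map_poly_inj iota); rewrite map_G map_P Xm_sub_1 prodrXl. Qed.

Let G_mul Om Om' : G Om * G Om' = G (fun yx => Om yx + Om' yx)%N.
Proof. by rewrite -big_split; apply: eq_bigr => yx _; rewrite exprD. Qed.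

Let G_ext Om Om' : {in Sig, Om =1 Om'} -> G Om = G Om'.
Proof. by move=> H; apply: eq_bigr => yx S; rewrite H. Qed.

Let P_neq0 : P != 0. Proof. exact: Xm_sub_1_neq0. Qed.

Let G_compl Om : (forall yx, yx \in Sig -> (Om yx <= 2 ^ v)%N) ->
  G Om * G (fun yx => 2 ^ v - Om yx)%N = P.
Proof. by move=> le; rewrite G_mul -G_const; apply: G_ext => yx S; rewrite subnKC ?le. Qed.

Let G_dvd Om : (forall yx, yx \in Sig -> (Om yx <= 2 ^ v)%N) -> G Om %| P.
Proof. by move=> /G_compl <-; apply: dvdp_mulr. Qed.

Let mup_G Om yx : yx \in Sig ->
  mup (zeta n ^+ ordz n_gt0 (et yx)) (map_poly iota (G Om)) = Om yx.
Proof.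
move=> S; rewrite map_G (@mup_prod_XsubCX _ _ (fun i : 'I_n => zeta n ^+ i)
  (fun i : 'I_n => Om (coset_rep i))); last exact: prim_ord_inj.
by rewrite (rep_mod (ordz_mod _ _)) rep_et.
Qed.

Let G_eqp Om Om' : G Om != 0 -> G Om %= G Om' -> {in Sig, Om =1 Om'}.
Proof.
move=> G0 GG yx S; rewrite -(mup_G Om S) -(mup_G Om' S); apply: eqp_mup.
  by rewrite map_poly_eq0.
by rewrite eqp_map.
Qed.

Let dvd_G (g : {poly F}) : g %| P -> exists2 Om : yxindex s n -> nat,
  (forall yx, yx \in Sig -> (Om yx <= 2 ^ v)%N) & g %= G Om.
Proof.
move=> gP; have g0 : g != 0 by apply: contraTneq gP => ->; rewrite dvd0p.
pose mu z := mup (zeta n ^ z) (map_poly iota g).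
have mu_mod z z' : (z = z' %[mod n])%Z -> mu z = mu z'.
  by move=> zz; rewrite /mu; congr mup; apply/eqP; rewrite (prim_exprz_eq _ _ zeta_prim) zz.
have mu_q z k : mu (z * q%:Z ^+ k) = mu z.
  elim: k => [|k IH]; first by rewrite expr0 mulr1.
  by rewrite -{}IH exprSr mulrA /mu -exprz_exp -exprnP -hF mup_Frobenius.
have gP' : map_poly iota g %| (\prod_(i < n) ('X - (zeta n ^+ i)%:P)) ^+ (2 ^ v).
  by rewrite -Xm_sub_1 -map_P dvdp_map.
have gE := dvdp_prod_XsubCX (prim_ord_inj zeta_prim) gP'.
exists (fun yx => mu (et yx)) => [yx S|].
  have P'0 : map_poly iota P != 0 by rewrite map_poly_eq0.
  (* The bound 2^v is the multiplicity of the same root in X^m - 1, a multiple of g. *)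
  rewrite -(mup_G (fun=> (2 ^ v)%N) S) G_const /mu (exprz_ordz n_gt0 zeta_prim).
  rewrite mup_geq //; apply: (@dvdp_trans _ (map_poly iota g)); last by rewrite dvdp_map.
  by rewrite -mup_geq ?map_poly_eq0.
rewrite -(eqp_map iota) map_G; apply: (eqp_trans gE).
apply/eqpP; exists (1, 1); rewrite ?oner_eq0 //=; congr (_ *: _).
apply: eq_bigr => i _; congr (_ ^+ _).
have [_ /(coset_memP n_gt0 co_qn)[k ik]] := repP i.
by rewrite -(mu_q _ k) -(mu_mod _ _ ik).
Qed.

Let M_opp yx : M (- et yx) = M (et (opposite_rep yx)).
Proof.
rewrite /M /cosetpolyF; congr descend.
by apply: (cosetpoly_eq n_gt0 co_qn zeta_prim); rewrite coset_mem_sym.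
Qed.

Let opp_reindex (f : yxindex s n -> {poly F}) :
  \prod_(yx in Sig) f (opposite_rep yx) = \prod_(yx in Sig) f yx.
Proof.
rewrite [RHS](reindex_onto opposite_rep opposite_rep) /=; last by move=> yx; apply: oppK.
apply: eq_bigl => yx; rewrite opp_Sig; apply/idP/eqP => [/oppK //|<-].
exact: opp_Sig.
Qed.

Let G_opp Om : \prod_(yx in Sig) M (- et yx) ^+ Om yx = G (fun yx => Om (opposite_rep yx)).
Proof.
rewrite /G -(opp_reindex (fun yx => M (et yx) ^+ Om (opposite_rep yx))).
by apply: eq_bigr => yx S; rewrite M_opp oppK.
Qed.

(** Membership of x in the dual means that X^m - 1 divides x times the reciprocal of [G Om], which
    is [G] with the exponents of the opposite cosets. That polynomial is a factor of X^m - 1 and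
    cancels, leaving divisibility of x by the complementary factor. *)
Let dual_G Om : (forall yx, yx \in Sig -> (Om yx <= 2 ^ v)%N) ->
  dual_code (ideal_code m (G Om)) =
  ideal_code m (G (fun yx => 2 ^ v - Om (opposite_rep yx))%N).
Proof.
move=> le; have le' yx : yx \in Sig -> (Om (opposite_rep yx) <= 2 ^ v)%N.
  by move=> _; apply/le/opp_Sig.
apply/setP => x; rewrite mem_dual_ideal_code // mem_ideal_code //; last first.
  by apply: G_dvd => yx S; apply: leq_subr.
rewrite -/P -(dvdp_map iota) map_P rmorphM /= map_comp_poly map_polyXn.
have rec : reciprocal m (map_poly iota (G Om))
    (map_poly iota (G (fun yx => Om (opposite_rep yx)))).
  rewrite -G_opp !rmorph_prod; apply: reciprocal_prod => yx _.
  rewrite !rmorphXn /= !map_M; apply: reciprocalX.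
  exact: reciprocal_cosetpoly.
rewrite (dvdp_reciprocal m_gt0 _ rec) -map_P -rmorphM dvdp_map -(G_compl le').
rewrite [rVpoly x * _]mulrC dvdp_mul2l //; apply: contraTneq (P_neq0) => G0.
by rewrite -(G_compl le') G0 mul0r eqxx.
Qed.

Let self_dual_G Om : (forall yx, yx \in Sig -> (Om yx <= 2 ^ v)%N) ->
  self_dual (ideal_code m (G Om)) <->
  {in Sig, forall yx, Om yx = (2 ^ v - Om (opposite_rep yx))%N}.
Proof.
move=> le; rewrite /self_dual dual_G //.
have dvd' : G (fun yx => 2 ^ v - Om (opposite_rep yx))%N %| P.
  by apply: G_dvd => yx _; apply: leq_subr.
rewrite (ideal_code_inj m_gt0 (G_dvd le) dvd'); split=> [|H].
  by apply: G_eqp; apply: contraTneq (G_dvd le) => ->; rewrite dvd0p.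
by rewrite (G_ext H) eqpxx.
Qed.

Let double_half : (2 ^ v = 2 ^ (v - 1) + 2 ^ (v - 1))%N.
Proof. by rewrite -{1}(subnK hv) addn1 expnS mul2n addnn. Qed.

Let half_fixed k : (k <= 2 ^ v)%N -> k = (2 ^ v - k)%N -> k = (2 ^ (v - 1))%N.
Proof.
move=> le E; have := subnK le; rewrite -E double_half !addnn.
exact: double_inj.
Qed.

(** When t = 1 the class of 0 lies in [Sigma'']; the second condition, applied to this class paired
    with itself, still forces the exponent 2^(v-1). *)
Lemma self_dual_criterion (Om : yxindex s n -> nat) :
  (forall yx, yx \in Sig -> (Om yx <= 2 ^ v)%N) ->
  self_dual (ideal_code m (\prod_(yx in Sig) M (et yx) ^+ Om yx)) <->
  (forall yx, yx \in Sigma' p e q n t sg -> Om yx = (2 ^ (v - 1))%N) /\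
  (forall yx yx', yx \in Sigma'' p e q n t sg -> yx' \in Sigma'' p e q n t sg ->
     opp_class p q eta yx yx' -> Om yx = (2 ^ v - Om yx')%N).
Proof.
move=> le; rewrite (self_dual_G le).
have S'U yx : yx \in Sigma' p e q n t sg -> yx \in U by rewrite in_setU orbC => ->.
have S'opposite_rep yx : yx \in Sigma' p e q n t sg -> yx \in Sig /\ opposite_rep yx = yx.
  by move=> /S'U yU; have S := U_sub yU; split=> //; apply/eqP; rewrite -mem_U.
split=> [H|[H1 H2] yx S].
  split=> [yx /S'opposite_rep[S oy]|yx yx']; last first.
    by rewrite !in_setD => /andP[_ S] /andP[_ S'] /(opp_classP _ S') <-; apply: H.
  by apply: half_fixed (le _ S) _; rewrite {1}H // oy.
case: (boolP (yx \in Sigma' p e q n t sg)) => yS'.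
  by have [_ ->] := S'opposite_rep yx yS'; rewrite H1 // double_half addnK.
apply: H2; [by rewrite in_setD yS'| |exact/opp_classP].
(* [Sigma''] is stable under opposition: an opposite lying in [Sigma'] would be its own opposite,
   hence equal to [yx]. *)
rewrite in_setD opp_Sig andbT; apply: contra yS' => oS'.
by have [_] := S'opposite_rep _ oS'; rewrite oppK // => ->.
Qed.

(** On D the classes of [sim] are pairs of distinct opposite indices, so D is the disjoint union of
    T and its opposite. The exponent is free on T, complementary on the opposite of T, and 2^(v-1)
    on U. *)
Lemma self_dual_codes (T : {set yxindex s n}) :
    representatives (Sigma'' p e q n t sg :\: Sigma_0 p e q n) (sim p q eta) T ->
    forall C : {set 'rV[F]_m}, cyclic_code C ->
  self_dual C <->
  exists Om : yxindex s n -> nat,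
    (forall yx, yx \in T -> (Om yx <= 2 ^ v)%N) /\
    C = ideal_code m
      ((\prod_(yx in U) M (et yx) ^+ (2 ^ (v - 1))) *
       (\prod_(yx in T) (M (et yx) ^+ Om yx * M (- et yx) ^+ (2 ^ v - Om yx)))).
Proof.
set D := Sigma'' _ _ _ _ _ _ :\: _ => -[TD Trep] C cycC.
have DE yx : (yx \in D) = (yx \in Sig) && (yx \notin U).
  by rewrite !in_setD in_setU negb_or andbA andbC.
have D_Sig yx : yx \in D -> yx \in Sig by rewrite DE => /andP[].
have D_neq yx : yx \in D -> opposite_rep yx != yx.
  by rewrite DE => /andP[S]; rewrite mem_U.
have oppD yx : yx \in D -> opposite_rep yx \in D.
  move=> yD; have S := D_Sig _ yD; rewrite DE opp_Sig mem_U // oppK // eq_sym.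
  exact: D_neq.
have T_D yx : yx \in T -> yx \in D by apply/subsetP.
(* Otherwise [yx] and its opposite would be two distinct representatives of the same class. *)
have oppT yx : yx \in T -> opposite_rep yx \notin T.
  move=> yT; have yD := T_D _ yT; apply/negP => oT.
  have [b [_ uniq_b]] := Trep yx yD.
  have b1 : b = opposite_rep yx.
    by apply: uniq_b; split=> //; apply/(simP (D_Sig _ yD) (opp_Sig _)); right.
  have b2 : b = yx.
    by apply: uniq_b; split=> //; apply/(simP (D_Sig _ yD) (D_Sig _ yD)); left.
  by have /eqP[] := D_neq _ yD; rewrite -b1.
have DT yx : yx \in D -> yx \notin T -> opposite_rep yx \in T.
  move=> yD ynT; have [b [[bT]]] := Trep yx yD.
  move=> /(simP (D_Sig _ yD) (D_Sig _ (T_D _ bT)))[yb|-> //].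
  by rewrite yb bT in ynT.
have prodT Om : (forall yx, yx \in U -> Om yx = (2 ^ (v - 1))%N) ->
    (forall yx, yx \in T -> Om (opposite_rep yx) = (2 ^ v - Om yx)%N) ->
  (\prod_(yx in U) M (et yx) ^+ (2 ^ (v - 1))) *
       (\prod_(yx in T) (M (et yx) ^+ Om yx * M (- et yx) ^+ (2 ^ v - Om yx))) = G Om.
  move=> OmU OmT; rewrite /G [RHS](big_setID U) /=; congr (_ * _).
    apply: eq_big => [yx|yx yU]; last by rewrite OmU.
    by rewrite in_setI; case: (boolP (yx \in U)) => [/U_sub ->|]; rewrite ?andbF.
  rewrite [RHS](eq_bigl (fun yx => yx \in D)) => [|yx]; last by rewrite in_setD DE andbC.
  rewrite [RHS](big_setID T) big_split /=; congr (_ * _).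
    apply: eq_bigl => yx; rewrite in_setI andbC.
    by case: (boolP (yx \in T)) => // /T_D ->.
  have -> : D :\: T = opposite_rep @: T.
    apply/setP => yx; rewrite in_setD; apply/andP/imsetP => [[ynT yD]|[b bT ->]].
      by exists (opposite_rep yx); rewrite ?oppK ?D_Sig // DT.
    by rewrite oppT // oppD // T_D.
  rewrite big_imset /=; last by move=> x y /T_D/D_Sig Sx /T_D/D_Sig Sy; apply: opp_inj.
  by apply: eq_bigr => yx yT; rewrite M_opp OmT.
split=> [sdC|[Om [le CE]]].
  have [g gP CE] := cyclic_code_generator m_gt0 cycC.
  have [Om le gG] := dvd_G gP.
  have {}CE : C = ideal_code m (G Om).
    by rewrite CE; apply/(ideal_code_inj m_gt0) => //; apply: G_dvd.
  rewrite CE in sdC; have H := (self_dual_G le).1 sdC.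
  exists Om; split=> [yx /T_D/D_Sig/le //|].
  rewrite prodT // => [yx yU|yx /T_D/D_Sig S]; last by rewrite H // oppK.
  have S := U_sub yU; apply: half_fixed (le _ S) _; rewrite {1}H //.
  by move: yU; rewrite mem_U // => /eqP ->.
(* The only extension of the exponents given on T that satisfies the self-duality equations on
   [Sig]. *)
pose Om' yx := if yx \in U then (2 ^ (v - 1))%N else
  if yx \in T then Om yx else (2 ^ v - Om (opposite_rep yx))%N.
have T_nU yx : yx \in T -> yx \notin U by move=> /T_D; rewrite DE => /andP[].
have D_nU yx : yx \in D -> yx \notin U by rewrite DE => /andP[].
have OmT yx : yx \in T -> Om' yx = Om yx.
  by move=> yT; rewrite /Om' (negbTE (T_nU _ yT)) yT.
have OmU yx : yx \in U -> Om' yx = (2 ^ (v - 1))%N by rewrite /Om' => ->.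
have OmO yx : yx \in T -> Om' (opposite_rep yx) = (2 ^ v - Om' yx)%N.
  move=> yT; have yD := T_D _ yT; rewrite (OmT _ yT) /Om' (negbTE (D_nU _ (oppD _ yD))).
  by rewrite (negbTE (oppT _ yT)) oppK ?D_Sig.
have le' yx : yx \in Sig -> (Om' yx <= 2 ^ v)%N.
  move=> S; rewrite /Om'; case: ifP => _; first by rewrite double_half leq_addr.
  by case: ifP => [/le //|_]; apply: leq_subr.
have {CE} -> : C = ideal_code m (G Om').
  rewrite CE -prodT //; congr (ideal_code m (_ * _)).
  by apply: eq_bigr => yx yT; rewrite OmT.
apply/(self_dual_G le') => yx S; case: (boolP (yx \in U)) => [yU|ynU].
  have /eqP oy : opposite_rep yx == yx by rewrite -mem_U.
  by rewrite oy OmU // double_half addnK.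
have yD : yx \in D by rewrite DE S.
case: (boolP (yx \in T)) => [yT|ynT]; first by rewrite OmO // subKn // le'.
by rewrite -[in LHS](oppK S) OmO // DT.
Qed.

End SelfDualCodes.

Theorem theorem5p3
  (F : finFieldType) (L : fieldType) (iota : {rmorphism F -> L})
  (zeta : nat -> L)
  (a q v s n m : nat) (p e : 'I_s -> nat) (eta : 'I_s -> int)
  (t : nat) (sg : nat -> nat)
  (ha : (1 <= a)%N) (hq : q = (2 ^ a)%N) (hF : #|F| = q)
  (hzeta : compatible_roots zeta q)
  (hv : (1 <= v)%N)
  (hp : forall i, prime (p i) /\ odd (p i)) (hpinj : injective p)
  (he : forall i, (0 < e i)%N)
  (hn : n = (\prod_(i < s) p i ^ e i)%N) (hm : m = (2 ^ v * n)%N)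
  (hord : forall i j : 'I_s, (i <= j)%N -> (v2ord p q i <= v2ord p q j)%N)
  (hsg : grouping p q t sg)
  (heta : primitive_root_system p e eta) :
  let M := cosetpolyF iota zeta n q in
  let Sig := Sigma p e q n in
  let Sig' := Sigma' p e q n t sg in
  let Sig'' := Sigma'' p e q n t sg in
  let Sig0 := Sigma_0 p e q n in
  [/\ forall Omega : yxindex s n -> nat,
        (forall yx, yx \in Sig -> (Omega yx <= 2 ^ v)%N) ->
        self_dual (ideal_code m
          (\prod_(yx in Sig) M (eta_yx p eta yx) ^+ Omega yx)) <->
        (forall yx, yx \in Sig' -> Omega yx = (2 ^ (v - 1))%N) /\
        (forall yx yx', yx \in Sig'' -> yx' \in Sig'' ->
           opp_class p q eta yx yx' -> Omega yx = (2 ^ v - Omega yx')%N),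
      forall T : {set yxindex s n},
        representatives (Sig'' :\: Sig0) (sim p q eta) T ->
        forall C : {set 'rV[F]_m}, cyclic_code C ->
        self_dual C <->
        exists Omega : yxindex s n -> nat,
          (forall yx, yx \in T -> (Omega yx <= 2 ^ v)%N) /\
          C = ideal_code m
            ((\prod_(yx in Sig0 :|: Sig') M (eta_yx p eta yx) ^+ (2 ^ (v - 1))) *
             (\prod_(yx in T) (M (eta_yx p eta yx) ^+ Omega yx *
                M (- eta_yx p eta yx) ^+ (2 ^ v - Omega yx))))
    & forall yx, yx \in Sig ->
        cosetpoly zeta n q (- eta_yx p eta yx) =
        \sum_(i < (omega p e q yx).+1)
          ((-1) ^+ (omega p e q yx - i) *
           \sum_(U : {set 'I_(omega p e q yx)} | #|U| == (omega p e q yx - i)%N)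
              \prod_(u in U)
                zeta (\prod_(k < s) p k ^ (e k - ypart yx k - Mexp p e q yx k))%N
                  ^ (- (eta_x eta yx * q%:Z ^+ u))) *:
          'X^((\prod_(k < s) p k ^ Mexp p e q yx k) * i)].
Proof.
move=> M Sig Sig' Sig'' Sig0.
have p_prime i : prime (p i) by case: (hp i).
have p_odd i : odd (p i) by case: (hp i).
have q_gt1 : (1 < q)%N by rewrite hq -{1}(exp1n a) ltn_exp2r.
have co_qn : coprime q n by rewrite hq coprimeXl // coprime2n (n_odd p_odd hn).
split.
- move=> Om; exact: (self_dual_criterion iota ha hq hF hzeta hv p_prime p_odd
    hpinj he hn hm hsg heta).
- move=> T; exact: (self_dual_codes iota ha hq hF hzeta hv p_prime p_odd
    hpinj he hn hm hsg heta).
- move=> yx; exact: (cosetpoly_expansion p_prime p_odd hpinj he hn co_qn q_gt1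
    heta hzeta).
Qed.
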